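(* The family of all $\dot\Delta_i^{(\delta,\bar c)}$ ($(\delta,\bar c)\in\mathbf{N}^*\times\mathbf{E}_q$, $1\le i\le\delta$) together with $\dot\Delta^{(0)}:=\nu$ topologically generates the Lie algebra $\tilde{\mathfrak{st}}$.
   Context: Fix $q\in\mathbf{C}$, $|q|>1$, $\sigma_qf(z)=f(qz)$, $\mathbf{E}_q=\mathbf{C}^*/q^{\mathbf{Z}}$ (written multiplicatively), $\bar c$ the class of $c$, $[c;q]=cq^{\mathbf{Z}}$. $\mathbf{C}(\{z\})$ is the field of convergent Laurent series at $0$. ''Topologically generates'' means that the generated Lie subalgebra is dense. **Category.** $\mathcal{E}^{(0)}$: objects are matrices $A\in \mathrm{GL}_n(\mathbf{C}(\{z\}))$ (systems $\sigma_qX=AX$); morphisms $A\to B$ are $F\in \mathrm{Mat}_{p,n}(\mathbf{C}(\{z\}))$ with $(\sigma_qF)A=BF$; $F[A]=(\sigma_qF)AF^{-1}$. $\mathcal{E}_1^{(0)}$ is the full subcategory of systems with integral slopes, i.e. isomorphic to some $A$ in Birkhoff-Guenther normal form: block upper triangular with diagonal blocks $z^{\mu_i}A_i$ ($\mu_1<\dots<\mu_k$ integers, $A_i\in \mathrm{GL}_{r_i}(\mathbf{C})$) and with $(i,j)$ blocks ($i<j$) having entries in $\sum_{\mu_i\le \ell<\mu_j}\mathbf{C}z^\ell$. $A_0$ is the block diagonal part of $A$; for a morphism $F$, $\mathrm{gr}F=F_0$ keeps only the blocks of $F$ relating equal slopes. This gives a functor $\mathrm{gr}$ to the full subcategory $\mathcal{E}_{p,1}^{(0)}$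 of pure systems (those isomorphic to some $A_0$). Fix $a\in\mathbf{C}^*$; the fiber functor is $A\mapsto\mathbf{C}^n$, $F\mapsto F_0(a)$ (extended to all objects through isomorphisms). $G_1^{(0)}$ and $G_{p,1}^{(0)}$ are the tannakian Galois groups of $\mathcal{E}_1^{(0)}$ and $\mathcal{E}_{p,1}^{(0)}$. **Pure group.** $G_{p,1}^{(0)}=\mathbf{C}^*\times \mathrm{Hom}_{gr}(\mathbf{E}_q,\mathbf{C}^* )\times\mathbf{C}$ ($\mathrm{Hom}_{gr}$: abstract group homomorphisms), where $(t,\gamma,\lambda)$ acts on $A_0$ as the block diagonal matrix with blocks $t^{\mu_i}\gamma(A_{i,s})A_{i,u}^\lambda$ ($A_i=A_{i,s}A_{i,u}$ the multiplicative Jordan decomposition). Put $\tau=(1,1,1)$ (trivial $t$, trivial $\gamma$, $\lambda=1$) and $\nu=\log\tau$. **Stokes Lie algebra.** $\mathfrak{St}=\ker(G_1^{(0)}\to G_{p,1}^{(0)})$ (prounipotent), so $G_1^{(0)}=\mathfrak{St}\rtimes G_{p,1}^{(0)}$ via $\mathrm{gr}$; $\mathfrak{st}=\mathrm{Lie}(\mathfrak{St})$, $\tilde{\mathfrak{st}}=\mathbf{C}\nu\oplus\mathfrak{st}\subset\mathrm{Lie}(G_1^{(0)})$, with the inverse limit topology of the discrete topologies on its finite dimensional images in the objects of $\mathcal{E}_1^{(0)}$. An element $D\in\mathfrak{st}$ is a family $D(A)\in\mathfrak{g}_{A_0}(\mathbf{C})$, where $\mathfrak{g}_{A_0}$ is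 the Lie algebra of strictly block upper triangular matrices. Let $\mathfrak{g}_{A_0}^{(\delta,\bar c)}$ be the subspace of matrices supported on blocks $(i,j)$ with $\mu_j-\mu_i=\delta$ and, within them, mapping the generalized $e$-eigenspace of $A_j$ to the generalized $d$-eigenspace of $A_i$ with $d/e\in cq^{\mathbf{Z}}$. $\mathfrak{st}^{(\delta,\bar c)}$ is the set of $D\in\mathfrak{st}$ with $D(A)\in\mathfrak{g}_{A_0}^{(\delta,\bar c)}$ for all $A$; $\mathfrak{st}$ is the completed direct sum of the $\mathfrak{st}^{(\delta,\bar c)}$, $\delta\ge1$, $\bar c\in\mathbf{E}_q$. $D^{(\delta,\bar c)}$ denotes the component of $D$. **$q$-alien derivations.** Let $\mathfrak{G}_{A_0}$ be the group of block upper triangular matrices with identity diagonal blocks. Let $\Sigma_{A_0}$ be the finite set of $\bar c\in\mathbf{E}_q$ such that $q^{\mathbf{Z}}c^{\mu_i}\mathrm{Sp}(A_i)\cap q^{\mathbf{Z}}c^{\mu_j}\mathrm{Sp}(A_j)\neq\emptyset$ for some $i<j$. For $\bar c\notin\Sigma_{A_0}$ there is a unique $S_{\bar c}\hat F_A\in\mathfrak{G}_{A_0}(\mathcal{M}(\mathbf{C}^* ))$ with $(S_{\bar c}\hat F_A)[A_0]=A$ whose $(i,j)$ block has poles only on $[-c;q]$, of order $\le\mu_j-\mu_i$. Fix a base direction $\bar c_0$; for $\alpha\in\mathbf{E}_q$, $\Delta_\alpha(A)$ is the residue at $\beta=\alpha\in\Sigma_{A_0}$ of $\beta\mapsto\log\bigl((S_{\bar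 c_0}\hat F_A(a))^{-1}S_{\beta}\hat F_A(a)\bigr)$ (and $0$ for $\alpha\notin\Sigma_{A_0}$); this defines (when all is defined, then by continuity) an element $\Delta_\alpha\in\mathfrak{st}$, with components $\Delta_\alpha^{(\delta,\bar c)}$. For each $(\delta,\bar c)\in\mathbf{N}^*\times\mathbf{E}_q$ the space $(\tilde{\mathfrak{st}}/[\tilde{\mathfrak{st}},\tilde{\mathfrak{st}}])^{(\delta,\bar c)}$ has dimension $\delta$ and is spanned by the images of the $\Delta_\alpha^{(\delta,\bar c)}$ with $\alpha^\delta=\bar c$; for each $(\delta,\bar c)$ choose $\delta$ of these whose images form a basis and call them $\dot\Delta_i^{(\delta,\bar c)}$, $1\le i\le\delta$. *)

(* Defs.v *)
From HB Require Import structures.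
From mathcomp Require Import all_boot all_order all_algebra.
From mathcomp Require Export complex.
From mathcomp Require Import mxtens.
From mathcomp Require Import all_classical all_reals all_analysis.

Set Implicit Arguments.
Unset Strict Implicit.
Unset Printing Implicit Defensive.

Import Order.TTheory GRing.Theory Num.Theory.
Import numFieldNormedType.Exports.
Local Open Scope classical_set_scope.
Local Open Scope ring_scope.

(* Everything is defined over a numClosedFieldType K, so that the topology of
   K is inferred; the theorem is about K = R[i] with R : realType. *)

Section LaurentSeries.
Variable K : numClosedFieldType.

(* F : laurent m n is the formal series \sum_k F k z^k with matrix
   coefficients, i.e. an m x n matrix of formal series. *)
Definition laurent (m n : nat) : Type := int -> 'M[K]_(m, n).

(* Mat_{m,n}(C({z})): finitely many negative powers of z, and convergence at
   some z <> 0. *)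
Definition convergent m n (F : laurent m n) : Prop :=
  (exists N : int, forall k : int, k < N -> F k = 0) /\
  (exists2 z : K, z != 0 &
     forall i j, cvgn (series (fun k : nat => F k%:Z i j * z ^+ k))).

(* Big operators over [set: int] are finitely supported sums: they are the
   Cauchy products when the factors have finitely many negative powers. *)
Definition lmul m n p (F : laurent m n) (G : laurent n p) : laurent m p :=
  fun k => \sum_(i \in [set: int]) F i *m G (k - i).

Definition lkron m n p r (F : laurent m n) (G : laurent p r) :
    laurent (m * p) (n * r) :=
  fun k => \sum_(i \in [set: int]) tensmx (F i) (G (k - i)).

Definition lone n : laurent n n := fun k => (k == 0)%:R%:M.

Definition sigma_q (q : K) m n (F : laurent m n) : laurent m n :=
  fun k => q ^ k *: F k.

(* Evaluation of a Laurent polynomial. *)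
Definition leval m n (F : laurent m n) (z : K) : 'M[K]_(m, n) :=
  \sum_(k \in [set: int]) z ^ k *: F k.

Definition is_inverse n (F G : laurent n n) : Prop :=
  [/\ convergent F, convergent G, lmul F G = @lone n & lmul G F = @lone n].

Definition is_GL n (F : laurent n n) : Prop := exists G, is_inverse F G.

End LaurentSeries.

Section Category.
Variables (K : numClosedFieldType) (q : K).

Definition is_morphism n p (A : laurent K n n) (B : laurent K p p)
    (F : laurent K p n) : Prop :=
  convergent F /\ lmul (sigma_q q F) A = lmul B F.

(* mu i is the slope of the i-th basis vector; F : laurent p n goes from a
   space of slopes mu to a space of slopes nu. *)
Definition gr_part n p (mu : 'I_n -> int) (nu : 'I_p -> int)
    (F : laurent K p n) : laurent K p n :=
  fun k => \matrix_(i, j) if nu i == mu j then F k i j else 0.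

(* The block diagonal matrix diag(A_1, ..., A_k), without the powers of z. *)
Definition lead n (mu : 'I_n -> int) (N : laurent K n n) : 'M[K]_n :=
  \matrix_(i, j) if mu i == mu j then N (mu i) i j else 0.

(* Birkhoff-Guenther normal form, up to the order of the basis: blocks are
   indexed by the slopes and mu is not required to be nondecreasing. For a
   nondecreasing mu this is the block upper triangular form; in general it is
   conjugate to that form by a permutation matrix. Tensor products of normal
   forms are normal forms in this sense, but are not sorted. *)
Definition normal_form n (mu : 'I_n -> int) (N : laurent K n n) : Prop :=
  lead mu N \in unitmx /\
  forall k i j, N k i j != 0 ->
    (mu i = mu j /\ k = mu i) \/ (mu i <= k /\ k < mu j).

(* Systems with integral slopes, each with an isomorphism to a normal form.
   Forgetting the isomorphism is an equivalence with the full subcategory of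
   the systems that have one; the isomorphism is what extends the fiber
   functor from the normal forms to all objects. *)
Record E1 (n : nat) : Type := MkE1 {
  sysmx : laurent K n n;
  slope : 'I_n -> int;
  nform : laurent K n n;
  toNF : laurent K n n;
  ofNF : laurent K n n;
  sysmx_GL : is_GL sysmx;
  nformP : normal_form slope nform;
  toNF_inv : is_inverse toNF ofNF;
  toNF_mor : is_morphism sysmx nform toNF }.

Definition leadmx n (X : E1 n) : 'M[K]_n := lead (slope X) (nform X).

Definition E1_mor n p (X : E1 n) (Y : E1 p) (F : laurent K p n) : Prop :=
  is_morphism (sysmx X) (sysmx Y) F.

(* Pure systems: isomorphic to some A_0. *)
Definition is_pure n (X : E1 n) : Prop :=
  exists (mu : 'I_n -> int) (N : laurent K n n) (F : laurent K n n),
    [/\ normal_form mu N, gr_part mu mu N = N, is_GL F &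
        is_morphism (sysmx X) N F].

(* The fiber functor on a morphism F : X -> Y; gr F is a Laurent polynomial,
   since q^k F_k A = B F_k for its coefficients, with A and B constant and
   invertible. *)
Definition omega (a : K) n p (X : E1 n) (Y : E1 p) (F : laurent K p n) :
    'M[K]_(p, n) :=
  leval (gr_part (slope X) (slope Y) (lmul (lmul (toNF Y) F) (ofNF X))) a.

Definition is_tensor m n (X : E1 m) (Y : E1 n) (Z : E1 (m * n)) : Prop :=
  [/\ sysmx Z = lkron (sysmx X) (sysmx Y),
      forall k, slope Z k =
        slope X (mxtens_unindex k).1 + slope Y (mxtens_unindex k).2,
      nform Z = lkron (nform X) (nform Y) &
      toNF Z = lkron (toNF X) (toNF Y)].

Definition is_unit_object (Z : E1 1) : Prop :=
  [/\ sysmx Z = @lone K 1, forall k, slope Z k = 0,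
      nform Z = @lone K 1 & toNF Z = @lone K 1].

End Category.

Section GaloisGroup.
Variables (K : numClosedFieldType) (q a : K).

Definition fiber_endo (S : Type) : Type := forall n, E1 q n -> 'M[S]_n.

Definition extend_scalars (S : comAlgType K) m n (M : 'M[K]_(m, n)) :
    'M[S]_(m, n) := map_mx (fun x : K => x%:A) M.

(* S-points of G_1^(0): the tensor automorphisms of the fiber functor after
   extension of scalars to S. *)
Definition Galois (S : comAlgType K) : set (fiber_endo S) :=
  [set g : fiber_endo S | [/\
    forall n (X : E1 q n),
      exists h : 'M[S]_n, g n X *m h = 1%:M /\ h *m g n X = 1%:M,
    forall n p (X : E1 q n) (Y : E1 q p) (F : laurent K p n),
      E1_mor X Y F ->
      g p Y *m extend_scalars S (omega a X Y F) =
      extend_scalars S (omega a X Y F) *m g n X,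
    forall m n (X : E1 q m) (Y : E1 q n) (Z : E1 q (m * n)),
      is_tensor X Y Z -> g _ Z = tensmx (g m X) (g n Y) &
    forall Z : E1 q 1, is_unit_object Z -> g _ Z = 1%:M]].

(* The kernel of the restriction to the pure objects. *)
Definition Stokes (S : comAlgType K) : set (fiber_endo S) :=
  [set g : fiber_endo S | Galois g /\
     forall n (X : E1 q n), is_pure X -> g n X = 1%:M].

(* The Lie algebra of a group functor: the D such that 1 + eps D is a point
   over the dual numbers C[eps] = C[X] / (X^2). *)
Definition LieOf (G : forall S : comAlgType K, set (fiber_endo S)) :
    set (fiber_endo K) :=
  [set D : fiber_endo K | G ({poly %/ 'X^2 : {poly K}} : comAlgType K)
     (fun n X => 1%:M + qpolyX ('X^2) *: extend_scalars _ (D n X))].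

Definition st : set (fiber_endo K) := LieOf Stokes.

End GaloisGroup.

Section LieFamilies.
Variables (K : numClosedFieldType) (q : K).
Local Notation fam := (fiber_endo q K).

Definition fzero : fam := fun n X => 0.
Definition fadd (D E : fam) : fam := fun n X => D n X + E n X.
Definition fscale (x : K) (D : fam) : fam := fun n X => x *: D n X.
Definition fsum r (D : 'I_r -> fam) : fam := fun n X => \sum_k D k n X.
Definition bracket (D E : fam) : fam :=
  fun n X => D n X *m E n X - E n X *m D n X.

(* Closure for the inverse limit of the discrete topologies on the images in
   the objects. *)
Definition tclosure (L : set fam) : set fam :=
  [set D : fam | forall r (n : 'I_r -> nat) (X : forall k, E1 q (n k)),
     exists2 E, L E & forall k, E _ (X k) = D _ (X k)].

Inductive lie_span (S : set fam) : fam -> Prop :=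
| lie_span_gen D : S D -> lie_span S D
| lie_span_zero : lie_span S fzero
| lie_span_add D E : lie_span S D -> lie_span S E -> lie_span S (fadd D E)
| lie_span_scale x D : lie_span S D -> lie_span S (fscale x D)
| lie_span_bracket D E :
    lie_span S D -> lie_span S E -> lie_span S (bracket D E).

Definition topologically_generates (S L : set fam) : Prop :=
  S `<=` L /\ L `<=` tclosure (lie_span S).

(* The closed derived ideal [L, L] of a topological Lie algebra L. *)
Definition derived (L : set fam) : set fam :=
  tclosure [set D : fam | exists r (E F : 'I_r -> fam),
    [/\ forall k, L (E k), forall k, L (F k) &
        D = fsum (fun k => bracket (E k) (F k))]].

(* The images of the B i in the ambient space modulo W form a basis of the
   image of V. *)
Definition basis_mod (V W : set fam) r (B : 'I_r -> fam) : Prop :=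
  [/\ forall i, V (B i),
      forall x : 'I_r -> K,
        W (fsum (fun i => fscale (x i) (B i))) -> forall i, x i = 0 &
      forall D, V D -> exists x : 'I_r -> K,
        W (fadd D (fscale (-1) (fsum (fun i => fscale (x i) (B i)))))].

End LieFamilies.

Section Tau.
Variable K : numClosedFieldType.

(* Logarithm of a unipotent matrix. *)
Definition logmx n (U : 'M[K]_n) : 'M[K]_n :=
  \sum_(1 <= k < n.+1) ((-1) ^+ k.+1 / k%:R) *: (U - 1%:M) ^+ k.

Definition unipotent n (U : 'M[K]_n) : Prop := (U - 1%:M) ^+ n = 0.

(* The unipotent factor of the multiplicative Jordan decomposition. *)
Definition jordan_u n (L : 'M[K]_n) : 'M[K]_n :=
  xget 1%:M [set U : 'M[K]_n | unipotent U /\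
    exists S, [/\ diagonalizable S, L = S *m U & S *m U = U *m S]].

Variables (q a : K).

(* tau = (1, 1, 1) acts on A_0 as diag(A_{i,u}), and on A through gr. *)
Definition tau : fiber_endo q K := fun n X => jordan_u (leadmx X).
Definition nu : fiber_endo q K := fun n X => logmx (tau X).

Definition st_tilde : set (fiber_endo q K) :=
  [set D : fiber_endo q K | exists (x : K) (E : fiber_endo q K),
     st a E /\ D = fadd (fscale x nu) E].

End Tau.

Arguments nu {K} q _ _.
Arguments st_tilde {K} q a _.

Section Weights.
Variables (K : numClosedFieldType) (q : K).

(* [c; q]; the elements of E_q are these subsets of C^*. *)
Definition qspiral (c : K) : set K := [set x | exists k : int, x = c * q ^ k].

Definition Ell : set (set K) := [set C | exists2 c, c != 0 & C = qspiral c].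

(* v is an e-eigenvector, resp. a generalized e-eigenvector, of the block of
   slope m of A_0. *)
Definition eigvec n (X : E1 q n) (m : int) (e : K) (v : 'cV[K]_n) : Prop :=
  (forall i, slope X i != m -> v i 0 = 0) /\ leadmx X *m v = e *: v.

Definition geigvec n (X : E1 q n) (m : int) (e : K) (v : 'cV[K]_n) : Prop :=
  (forall i, slope X i != m -> v i 0 = 0) /\
  (leadmx X - e%:M) ^+ n *m v = 0.

Definition gwt n (X : E1 q n) (d : nat) (c : set K) : set 'M[K]_n :=
  [set M : 'M[K]_n | (forall i j, M i j != 0 -> slope X j - slope X i = d%:Z) /\
    forall m e v, geigvec X m e v ->
      exists r (x : 'I_r -> K) (w : 'I_r -> 'cV[K]_n),
        (forall k, c (x k / e) /\ geigvec X (m - d%:Z) (x k) (w k)) /\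
        M *m v = \sum_k w k].

(* N is the (d, c)-component of M. *)
Definition is_component n (X : E1 q n) (d : nat) (c : set K)
    (M N : 'M[K]_n) : Prop :=
  gwt X d c N /\
  exists r (d' : 'I_r -> nat) (c' : 'I_r -> set K) (N' : 'I_r -> 'M[K]_n),
    (forall k, [/\ (0 < d' k)%N, Ell (c' k), (d' k, c' k) <> (d, c) &
                   gwt X (d' k) (c' k) (N' k)]) /\
    M = N + \sum_k N' k.

Variable a : K.

Definition st_wt (d : nat) (c : set K) : set (fiber_endo q K) :=
  [set D : fiber_endo q K | st a D /\ forall n (X : E1 q n), gwt X d c (D n X)].

Definition component_of (d : nat) (c : set K) (D E : fiber_endo q K) : Prop :=
  st_wt d c E /\
  forall n (X : E1 q n), is_component X d c (D n X) (E n X).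

End Weights.

Section AlienDerivations.
Variables (K : numClosedFieldType) (q : K).

Definition holomorphic_at (f : K -> K) (x : K) : Prop :=
  \forall z \near x, derivable f z 1.

(* r is the residue at x of f(z) dz. *)
Definition is_residue n (f : K -> 'M[K]_n) (x : K) (r : 'M[K]_n) : Prop :=
  exists l (p : nat -> 'M[K]_n) (g : K -> 'M[K]_n),
    [/\ p 0 = r, forall i j, holomorphic_at (fun z => g z i j) x &
        \forall z \near x^',
          f z = g z + \sum_(k < l.+1) ((z - x) ^- k.+1) *: p k].

(* c belongs to Sigma_{A_0}. *)
Definition singular_dir n (X : E1 q n) (c : set K) : Prop :=
  exists (m m' k : int) (d e x : K) (v w : 'cV[K]_n),
    [/\ m < m', v != 0 /\ eigvec X m d v, w != 0 /\ eigvec X m' e w, c x &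
        x ^ m * d = q ^ k * (x ^ m' * e)].

(* S is S_c F_A, as a function on the complement of [-c; q] in C^*: z lies on
   [-c; q] if and only if - z belongs to the class c. *)
Definition is_summation n (X : E1 q n) (c : set K) (S : K -> 'M[K]_n) : Prop :=
  [/\ forall z i j, z != 0 -> ~ c (- z) -> holomorphic_at (fun t => S t i j) z,
      forall p i j, c (- p) -> slope X i < slope X j ->
        exists2 g : K -> K, holomorphic_at g p &
          \forall z \near p^',
            S z i j = (z - p) ^ (slope X i - slope X j) * g z,
      forall z i j, z != 0 -> ~ c (- z) -> slope X j <= slope X i ->
        S z i j = (i == j)%:R &
      forall z, z != 0 -> ~ c (- z) ->
        S (q * z) *m leval (gr_part (slope X) (slope X) (nform X)) z =
        leval (nform X) z *m S z].

Definition summation n (X : E1 q n) (c : set K) : K -> 'M[K]_n :=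
  xget (fun _ => 1%:M) [set S : K -> 'M[K]_n | is_summation X c S].

Variable a : K.

Definition stokes_log n (X : E1 q n) (c b : set K) : 'M[K]_n :=
  logmx (invmx (summation X c a) *m summation X b a).

(* M is the residue at alpha of beta |-> log(S_c0(a)^-1 S_beta(a)), with
   respect to the invariant differential d beta / beta of E_q; it does not
   depend on the representative x of alpha. *)
Definition stokes_residue n (X : E1 q n) (c0 alpha : set K) (M : 'M[K]_n) :
    Prop :=
  forall x, alpha x ->
    is_residue (fun b => b^-1 *: stokes_log X c0 (qspiral q b)) x M.

(* D is Delta_alpha, relative to the base direction c0: an element of st given
   by the residue whenever S_c0 and S_beta, for beta near alpha, are defined
   at a, and by its limit along the base directions near c0 when that limit
   exists. *)
Definition is_alien_derivation (c0 alpha : set K) (D : fiber_endo q K) : Prop :=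
  [/\ st a D,
      forall n (X : E1 q n), ~ singular_dir X alpha -> D n X = 0,
      forall n (X : E1 q n) (M : 'M[K]_n),
        singular_dir X alpha -> ~ alpha (- a) ->
        ~ singular_dir X c0 -> ~ c0 (- a) ->
        stokes_residue X c0 alpha M -> D n X = M &
      forall n (X : E1 q n) (M : 'M[K]_n) (x : K) (Res : K -> 'M[K]_n),
        singular_dir X alpha -> ~ alpha (- a) -> c0 x ->
        (\forall c \near x^', stokes_residue X (qspiral q c) alpha (Res c)) ->
        (forall i j, Res c i j @[c --> x^'] --> M i j) ->
        D n X = M].

End AlienDerivations.

(* Main.v *)
Require Import Defs.
From mathcomp Require Import all_boot all_order all_algebra.
From mathcomp Require Import mxtens zify ring.
From mathcomp Require Import all_classical all_reals all_analysis.
Set Implicit Arguments.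
Unset Strict Implicit.
Unset Printing Implicit Defensive.
Import Order.TTheory GRing.Theory Num.Theory.
Import numFieldNormedType.Exports.
Local Open Scope classical_set_scope.
Local Open Scope ring_scope.

(** Write g for the Lie algebra st~ and l for the Lie algebra spanned by the
    chosen generators.  Density only has to be checked on finitely many
    objects at a time, and there g becomes a nilpotent Lie algebra of matrices.
    In a nilpotent Lie algebra a subalgebra l with l + [g, g] = g is everything:
    if every element of g is in l up to an error of depth k, then, writing the
    error terms of x and y as w and w', the bracket [x, y] differs from the
    bracket of their approximations by brackets of w and w' with elements of g
    or l, hence lies in l up to an error of depth k + 1.  Since
    g = l + [g, g], all of g then lies in l up to depth k + 1
    ([generated_upto_st_tilde]).  Depth is measured here by the number of
    factors in products of matrices ([words]), and such products vanish
    when they are long ([words_large]).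

    Three facts about g make this work.

    Nilpotency.  An element of g acts on an object as t nu plus a strictly block
    triangular matrix.  That st acts by strictly block triangular matrices
    ([st_slope_ge1]) comes from the filtration by the slopes: it consists of
    subobjects, and st vanishes on the graded pieces, which are pure.  That nu is
    block diagonal and nilpotent ([nu_block], [nu_nilpotent]) comes from the fact
    that the unipotent Jordan factor commutes with whatever commutes with the
    matrix ([jordan_uP]).

    Weights.  The hypothesis gives g = l + [g, g] one weight (delta, c) at a time,
    so an element D of st has to be, on finitely many objects, a finite sum of
    elements of st that are pure of some weight.  The component of D(X) of a given
    weight is cut out by the projectors of the slopes and of the generalized
    eigenspaces; the point is that it is again an element of st
    ([st_wt_part]).  For tensor products this is an orthogonality computation.
    For morphisms it rests on the shape of the morphisms between normal forms:
    the coefficient of z^k in the graded part of a morphism maps the generalized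
    eigenspace of x to the one of q^k x ([omega_decomp]), so that the classes
    modulo q^Z are respected.

    Linearization.  An element of st is a family D such that 1 + eps D is a tensor
    automorphism over the dual numbers; [stP] turns this into linear
    conditions on D. *)

(** * Generalized eigenspaces of a matrix *)

(** Moving [L] across the product: [(x - e) U V] is the difference of
    [U (L - e) V] and [U (L - x) V], and in each of these one of the two
    exponents has dropped. *)
Lemma generalized_eigen_orth (F : fieldType) n m p (L : 'M[F]_n) x e N N'
    (U : 'M[F]_(m, n)) (V : 'M[F]_(n, p)) :
  x != e -> U *m (L - x%:M) ^+ N = 0 -> (L - e%:M) ^+ N' *m V = 0 -> U *m V = 0.
Proof.
move=> xe; move: {2}(N + N')%N (leqnn (N + N')) => k.
elim: k N N' U V => [|k IH] N N' U V.
  by rewrite leqn0 addn_eq0 => /andP[/eqP-> /eqP->]; rewrite expr0 mulmx1 => ->; rewrite mul0mx.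
case: N => [|N] le; first by rewrite expr0 mulmx1 => ->; rewrite mul0mx.
case: N' le => [|N'] le hU; first by rewrite expr0 mul1mx => ->; rewrite mulmx0.
move=> hV.
have h1 : (U *m (L - x%:M)) *m V = 0.
  apply: (IH N N'.+1 _ _ _ _ hV); first by rewrite addSn ltnS in le.
  by rewrite -mulmxA mulmxE -exprS.
have h2 : U *m ((L - e%:M) *m V) = 0.
  apply: (IH N.+1 N' _ _ _ hU); first by rewrite addnS ltnS in le.
  by rewrite mulmxA mulmxE -exprSr.
have : (x - e) *: (U *m V) = 0.
  rewrite scalerBl; apply/eqP; rewrite subr_eq0; apply/eqP.
  move: h1 h2; rewrite mulmxBr mulmxBl mulmxBl mulmxBr !mul_scalar_mx mul_mx_scalar.
  rewrite -scalemxAl -scalemxAr mulmxA => /eqP; rewrite subr_eq0 => /eqP <- /eqP.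
  by rewrite subr_eq0 => /eqP <-.
by move/eqP; rewrite scaler_eq0 subr_eq0 (negPf xe) => /eqP.
Qed.

(** Modulo the product, the [z x] are the idempotents given by the Chinese
    remainder theorem; evaluated at a matrix that the product annihilates, they
    are its spectral projectors.  Stating this with divisibilities makes the
    induction on [s] go through from the empty product. *)
Lemma partial_fractions (F : fieldType) N (s : seq F) : uniq s ->
  exists z : F -> {poly F},
    \prod_(y <- s) ('X - y%:P) ^+ N %| 1 - \sum_(x <- s) z x /\
    forall x, x \in s ->
      \prod_(y <- s) ('X - y%:P) ^+ N %| ('X - x%:P) ^+ N * z x.
Proof.
elim: s => [|x s IH] /=.
  by exists (fun => 0); rewrite !big_nil dvd1p.
case/andP=> xs /IH [z [z1 z2]].
set f := \prod_(y <- s) _ in z1 z2.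
have : coprimep f (('X - x%:P) ^+ N).
  rewrite coprimep_expr // /f big_seq_cond.
  elim/big_ind: _ => [|p1 p2 h1 h2|y]; rewrite ?coprime1p ?coprimepMl ?h1 ?h2 //.
  rewrite andbT => ys; rewrite coprimep_expl // coprimep_XsubC root_XsubC.
  by apply: contra xs => /eqP ->.
case/Bezout_eq1_coprimepP=> [[a b]] /= hab.
exists (fun y => if y == x then a * f else b * ('X - x%:P) ^+ N * z y).
rewrite !big_cons eqxx -/f.
have -> : \sum_(y <- s) (if y == x then a * f else b * ('X - x%:P) ^+ N * z y)
   = b * ('X - x%:P) ^+ N * \sum_(y <- s) z y.
  rewrite mulr_sumr big_seq [RHS]big_seq; apply: eq_bigr => y ys.
  by case: eqP => // yx; rewrite -yx ys in xs.
split.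
  have -> : 1 - (a * f + b * ('X - x%:P) ^+ N * \sum_(y <- s) z y) =
     b * (('X - x%:P) ^+ N * (1 - \sum_(y <- s) z y)).
    rewrite opprD addrA -{1}hab [a * f + _]addrC addrK !mulrA mulrBr mulr1.
    by [].
  by rewrite dvdp_mull // dvdp_mul2l // expf_neq0 // polyXsubC_eq0.
move=> y; rewrite inE; case: eqP => [-> _|yx /= ys].
  by rewrite mulrCA dvdp_mull // mulrC.
rewrite mulrCA -mulrA dvdp_mull // dvdp_mul ?dvdpp //; exact: z2.
Qed.

(** Raising all multiplicities to the degree makes the exponent that defines
    the generalized eigenspaces independent of the eigenvalue. *)
Lemma prod_XsubC_dvd_undup (F : fieldType) (s : seq F) :
  \prod_(x <- s) ('X - x%:P) %| \prod_(y <- undup s) ('X - y%:P) ^+ size s.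
Proof.
rewrite -prodr_undup_exp_count.
elim: (undup s) => [|x t IH]; first by rewrite !big_nil dvd1p.
by rewrite !big_cons dvdp_mul // dvdp_exp2l // count_size.
Qed.

(** The values at [L] of the polynomials of [partial_fractions] for the
    characteristic polynomial, which annihilates [L] by Cayley-Hamilton. *)
Lemma spectral_partition (F : closedFieldType) n (L : 'M[F]_n) :
  exists (r : nat) (e : 'I_r -> F) (p : 'I_r -> 'M[F]_n),
    \sum_i p i = 1%:M /\
    forall i, [/\ (L - (e i)%:M) ^+ n *m p i = 0,
      p i *m (L - (e i)%:M) ^+ n = 0 &
      forall B, L *m B = B *m L -> p i *m B = B *m p i].
Proof.
case: n L => [|n] L.
  exists 0, (fun=> 0), (fun => 0); split; last by case.
  by apply/matrixP; case.
have [s hs] := closed_field_poly_normal (char_poly L).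
rewrite (monicP (char_poly_monic _)) scale1r in hs.
have ss : size s = n.+1.
  by apply: succn_inj; rewrite -[in LHS](size_prod_XsubC s id) -hs size_char_poly.
have [z [z1 z2]] := @partial_fractions _ n.+1 (undup s) (undup_uniq s).
set f := \prod_(y <- undup s) _ in z1 z2.
have fL g : f %| g -> horner_mx L g = 0.
  move=> fg; have : char_poly L %| g.
    by apply: dvdp_trans fg; rewrite hs /f -ss prod_XsubC_dvd_undup.
  by case/dvdpP=> h ->; rewrite rmorphM /= Cayley_Hamilton mulr0.
have hX x : horner_mx L (('X - x%:P) ^+ n.+1) = (L - x%:M) ^+ n.+1.
  by rewrite rmorphXn rmorphB /= horner_mx_X horner_mx_C.
exists (size (undup s)), (fun i => (undup s)`_i), (fun i => horner_mx L (z (undup s)`_i)).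
split.
  have := fL _ z1; rewrite rmorphB rmorph1 rmorph_sum /= => /eqP.
  rewrite subr_eq0 => /eqP/esym; rewrite (big_nth 0) big_mkord => ->.
  by [].
move=> i; have hi : (undup s)`_i \in undup s by rewrite mem_nth.
have h := fL _ (z2 _ hi); rewrite rmorphM /= hX in h.
split=> [//||B hB].
  by rewrite -hX mulmxE -rmorphM mulrC rmorphM /= hX.
exact: comm_horner_mx.
Qed.

(** * Dual numbers and the linearized Stokes group *)

Lemma tensmx11 (R : pzRingType) m n :
  tensmx 1%:M 1%:M = 1%:M :> 'M[R]_(m * n).
Proof.
apply/matrixP => i j; case: (mxtens_indexP i) => i1 i2.
case: (mxtens_indexP j) => j1 j2; rewrite tensmxE !mxE.
rewrite (inj_eq (can_inj (@mxtens_indexK m n))) xpair_eqE.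
by case: eqP; case: eqP => _ _; rewrite /= ?mulr1 ?mulr0.
Qed.

Section DualNumbers.
Variable K : numClosedFieldType.
Let Q : comAlgType K := {poly %/ 'X^2 : {poly K}}.
Let eps : Q := qpolyX 'X^2.
Local Notation ext := (@extend_scalars K Q _ _).

Lemma dual_eps2 : eps * eps = 0.
Proof.
rewrite /eps /qpolyX -in_qpolyM; apply: val_inj => /=.
by rewrite mk_monic_Xn -expr2 Pdiv.RingMonic.rmodpp ?monicXn.
Qed.

(** The independence of [1] and [eps], by which an equation over the dual
    numbers can be read off as an equation over [K]. *)
Lemma dual_alg_eps (x y : K) : x%:A + y *: eps = 0 -> x = 0 /\ y = 0.
Proof.
move=> h.
have hp : (x%:P + y *: 'X : {poly K}) = 0.
  have hX : Pdiv.CommonRing.rmodp 'X (mk_monic 'X^2) = 'X :> {poly K}.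
    by apply: (@qpolyXE K 'X^2); rewrite ?size_polyXn ?monicXn.
  have := congr1 val h.
  by rewrite /= hX => <-; rewrite alg_polyC.
have := congr1 (fun p : {poly K} => (p`_0, p`_1)) hp.
by rewrite !coefD !coefC !coefZ !coefX ?coef0 /= ?mulr0 ?coef0 ?mulr1 ?addr0 ?add0r => -[-> ->].
Qed.

Lemma extend_scalarsE m n (M : 'M[K]_(m, n)) :
  extend_scalars Q M = map_mx (in_alg Q) M.
Proof. by apply/matrixP => i j; rewrite !mxE. Qed.

Lemma extend_scalarsM m n p (M : 'M[K]_(m, n)) (N : 'M[K]_(n, p)) :
  ext (M *m N) = ext M *m ext N.
Proof. by rewrite !extend_scalarsE map_mxM. Qed.

Lemma dual_mx_eq m n (M N : 'M[K]_(m, n)) (B : 'M[Q]_(m, n)) :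
  B + eps *: ext M = B + eps *: ext N -> M = N.
Proof.
move/addrI => h; apply/matrixP => i j.
have := congr1 (fun B : 'M[Q]_(m, n) => B i j) h; rewrite !mxE => /eqP.
rewrite -subr_eq0 -!scalerAr !mulr1 -scalerBl => /eqP hh.
have [|_ /eqP] := @dual_alg_eps 0 (M i j - N i j); first by rewrite scale0r add0r.
by rewrite subr_eq0 => /eqP.
Qed.

End DualNumbers.

Section StLinear.
Variables (K : numClosedFieldType) (q a : K).

(** The first order part of the axioms of a tensor automorphism: the
    derivations of the fiber functor that satisfy the Leibniz rule. *)
Definition tensor_derivation (D : fiber_endo q K) : Prop :=
  [/\ forall n p (X : E1 q n) (Y : E1 q p) (F : laurent K p n),
        E1_mor X Y F -> D p Y *m omega a X Y F = omega a X Y F *m D n X,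
      forall m n (X : E1 q m) (Y : E1 q n) (Z : E1 q (m * n)),
        is_tensor X Y Z -> D _ Z = tensmx (D m X) 1%:M + tensmx 1%:M (D n Y) &
      forall Z : E1 q 1, is_unit_object Z -> D _ Z = 0].

Let Q : comAlgType K := {poly %/ 'X^2 : {poly K}}.
Let eps : Q := qpolyX 'X^2.
Local Notation ext := (@extend_scalars K Q _ _).

(** Over the dual numbers [1 + eps M] is invertible for every [M], so that the
    invertibility of a tensor automorphism puts no condition on its first order
    part. *)
Lemma dual_inv n (M : 'M[K]_n) :
  (1%:M + eps *: ext M) *m (1%:M - eps *: ext M) = 1%:M.
Proof.
rewrite mulmxBr mulmx1 mulmxDl mul1mx -scalemxAl -scalemxAr scalerA dual_eps2.
by rewrite scale0r addr0 addrK.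
Qed.

Lemma dual_tens m n (M : 'M[K]_m) (N : 'M[K]_n) :
  tensmx (1%:M + eps *: ext M) (1%:M + eps *: ext N) =
  1%:M + eps *: ext (tensmx M 1%:M + tensmx 1%:M N).
Proof.
rewrite -[1%:M in RHS](tensmx11 Q m n).
rewrite !extend_scalarsE; apply/matrixP => i j; rewrite !mxE.
rewrite rmorphD !rmorphM !rmorph_nat.
set x := GRing.in_alg _ _; set y := GRing.in_alg _ _; set u := _%:R; set v := _%:R.
rewrite mulrDl !mulrDr [eps * x * (eps * y)]mulrACA dual_eps2 mul0r addr0 -!addrA.
by congr (_ + _); rewrite addrC -mulrA; congr (_ + _); rewrite mulrCA.
Qed.

(** Each axiom for [1 + eps D] is an equation over the dual numbers whose
    constant terms agree, hence is the equation of the coefficients of [eps]. *)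
Lemma stP (D : fiber_endo q K) :
  st a D <-> tensor_derivation D /\ forall n (X : E1 q n), is_pure X -> D n X = 0.
Proof.
split.
  case; case=> [_ hmor htens hunit] hpure; split; first split.
  - move=> n p X Y F FP; have := hmor _ _ _ _ _ FP.
    rewrite mulmxDl mulmxDr mul1mx mulmx1 -scalemxAl -scalemxAr -!extend_scalarsM.
    exact: dual_mx_eq.
  - move=> m n X Y Z ZP; have := htens _ _ _ _ _ ZP => h.
    apply: (@dual_mx_eq K _ _ _ _ 1%:M); rewrite h.
    exact: dual_tens.
  - move=> Z ZP; have := hunit _ ZP => h.
    apply: (@dual_mx_eq K _ _ _ _ 1%:M); rewrite h.
    by rewrite extend_scalarsE map_mx0 scaler0 addr0.
  - move=> n X XP; have := hpure _ _ XP => h.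
    apply: (@dual_mx_eq K _ _ _ _ 1%:M); rewrite h.
    by rewrite extend_scalarsE map_mx0 scaler0 addr0.
case=> -[hmor htens hunit] hpure; split; first split.
- move=> n X; exists (1%:M - eps *: ext (D n X)); split; first exact: dual_inv.
  exact/mulmx1C/dual_inv.
- move=> n p X Y F FP.
  rewrite mulmxDl mulmxDr mul1mx mulmx1 -scalemxAl -scalemxAr -!extend_scalarsM.
  by rewrite hmor.
- move=> m n X Y Z ZP; rewrite (htens _ _ _ _ _ ZP); exact/esym/dual_tens.
- by move=> Z ZP; rewrite hunit // extend_scalarsE map_mx0 scaler0 addr0.
- by move=> n X XP; rewrite hpure // extend_scalarsE map_mx0 scaler0 addr0.
Qed.

End StLinear.

(** * Laurent series with matrix coefficients *)

Section IntSums.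

Lemma fsum_int_window (V : zmodType) (f : int -> V) (lo : int) (N : nat) :
  (forall k, f k != 0 -> lo <= k < lo + N%:Z) ->
  \sum_(k \in [set: int]) f k = \sum_(t < N) f (lo + t%:Z).
Proof.
move=> hf; rewrite -(@fsbig_widen _ _ _ _ [set` [seq lo + t%:Z | t <- iota 0 N]]) //.
  rewrite -fsbig_seq; last first.
    by rewrite map_inj_uniq ?iota_uniq // => x y /addrI [].
  rewrite big_map; have -> : iota 0 N = index_iota 0 N by rewrite /index_iota subn0.
  by rewrite big_mkord.
move=> k [_ hk]; apply/eqP; apply: contraT => /hf /andP[h1 h2].
case: hk; apply/mapP; exists `|k - lo|%N.
  by rewrite mem_iota add0n leq0n /=; lia.
by lia.
Qed.

Lemma fsum_int_single (V : zmodType) (f : int -> V) (k0 : int) :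
  (forall k, k != k0 -> f k = 0) -> \sum_(k \in [set: int]) f k = f k0.
Proof.
move=> hf; rewrite (@fsum_int_window _ _ k0 1) ?big_ord1 ?addr0 // => k hk.
have -> : k = k0 by apply/eqP; apply: contraNT hk => /hf ->.
by lia.
Qed.

(** By convention, a sum over an infinite support is the empty sum. *)
Lemma fsum_int_seq (V : zmodType) (f : int -> V) :
  exists s : seq int, \sum_(k \in [set: int]) f k = \sum_(k <- s) f k.
Proof. by eexists; reflexivity. Qed.

End IntSums.

Section Laurent.
Variable K : numClosedFieldType.

Definition bounded_below m n (F : laurent K m n) (lo : int) : Prop :=
  forall k : int, k < lo -> F k = 0.

(** The freedom in the choice of the window lets several products be expanded
    over the same one. *)
Lemma lmul_window m n p (F : laurent K m n) (G : laurent K n p) lo lo' b k N :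
  bounded_below F lo -> bounded_below G lo' -> b <= lo -> k < b + N%:Z + lo' ->
  lmul F G k = \sum_(t < N) F (b + t%:Z) *m G (k - (b + t%:Z)).
Proof.
move=> hF hG hb hN; apply: fsum_int_window => i hi.
have h1 : lo <= i.
  by rewrite leNgt; apply: contra hi => /hF ->; rewrite mul0mx.
have h2 : lo' <= k - i.
  by rewrite leNgt; apply: contra hi => /hG ->; rewrite mulmx0.
lia.
Qed.

Lemma bounded_below_lmul m n p (F : laurent K m n) (G : laurent K n p) lo lo' :
  bounded_below F lo -> bounded_below G lo' ->
  bounded_below (lmul F G) (lo + lo').
Proof.
move=> hF hG k hk; rewrite (lmul_window (N := 0) hF hG (lexx lo)) ?big_ord0 //; lia.
Qed.

(** Both sides expand to the same double sum over one window; without a lower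
    bound on the supports the products would not be finite sums. *)
Lemma lmulA m n p r (F : laurent K m n) (G : laurent K n p) (H : laurent K p r)
    f g h : bounded_below F f -> bounded_below G g -> bounded_below H h ->
  lmul (lmul F G) H = lmul F (lmul G H).
Proof.
move=> hF hG hH; apply/funext => k.
(* [-M, 2 M] contains every index at which a term of the double sum can be
   nonzero. *)
pose M := (`|k| + `|f| + `|g| + `|h|)%N.
have hFG := bounded_below_lmul hF hG; have hGH := bounded_below_lmul hG hH.
pose b : int := - M%:Z; pose N := (M + M + M).+1.
rewrite (lmul_window (b := b) (N := N) hFG hH); [|rewrite /b /M; lia|rewrite /b /N /M; lia].
rewrite (lmul_window (b := b) (N := N) hF hGH); [|rewrite /b /M; lia|rewrite /b /N /M; lia].
under eq_bigr => t _.
  have -> : lmul F G (b + t%:Z) *m H (k - (b + t%:Z)) =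
     \sum_(s < N) F (b + s%:Z) *m G (b + t%:Z - (b + s%:Z)) *m H (k - (b + t%:Z)).
    rewrite -mulmx_suml.
    have [lt|ge] := ltP (b + t%:Z) (b + N%:Z + g).
      by rewrite (lmul_window (b := b) (N := N) hF hG) //; rewrite /b /M; lia.
    by rewrite hH ?mulmx0 //; rewrite /b /N /M in ge *; lia.
  over.
rewrite exchange_big /=; apply: eq_bigr => s _.
have [lt|ge] := ltP (b + s%:Z) f.
  rewrite [F _]hF // mul0mx; apply: big1 => t _.
  by rewrite !mul0mx.
have -> : lmul G H (k - (b + s%:Z)) =
    \sum_(t < N) G (b + t%:Z - (b + s%:Z)) *m H (k - (b + t%:Z)).
  rewrite (lmul_window (b := - s%:Z) (N := N) hG hH).
  - apply: eq_bigr => t _; congr (G _ *m H _); lia.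
  - by rewrite /b /M in ge *; lia.
  - by rewrite /b /N /M; lia.
by rewrite mulmx_sumr; apply: eq_bigr => t _; rewrite mulmxA.
Qed.

Definition lconst m n (C : 'M[K]_(m, n)) : laurent K m n :=
  fun k => if k == 0 then C else 0.

Lemma lone_const n : @lone K n = lconst 1%:M.
Proof.
apply/funext => k; rewrite /lone /lconst; case: eqP => //= _.
by rewrite raddf0.
Qed.

Lemma bounded_below_lconst m n (C : 'M[K]_(m, n)) : bounded_below (lconst C) 0.
Proof. by move=> k hk; rewrite /lconst lt_eqF. Qed.

Lemma lmul_constl m n p (C : 'M[K]_(m, n)) (F : laurent K n p) :
  lmul (lconst C) F = fun k => C *m F k.
Proof.
apply/funext => k; rewrite /lmul (@fsum_int_single _ _ 0).
  by rewrite /lconst eqxx subr0.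
by move=> i hi; rewrite /lconst (negPf hi) mul0mx.
Qed.

Lemma lmul_constr m n p (C : 'M[K]_(n, p)) (F : laurent K m n) :
  lmul F (lconst C) = fun k => F k *m C.
Proof.
apply/funext => k; rewrite /lmul (@fsum_int_single _ _ k).
  by rewrite /lconst subrr eqxx.
by move=> i hi; rewrite /lconst subr_eq0 eq_sym (negPf hi) mulmx0.
Qed.

Lemma lmul1l m n (F : laurent K m n) : lmul (@lone K m) F = F.
Proof. by rewrite lone_const lmul_constl; apply/funext => k; rewrite mul1mx. Qed.

Lemma lmul1r m n (F : laurent K m n) : lmul F (@lone K n) = F.
Proof. by rewrite lone_const lmul_constr; apply/funext => k; rewrite mulmx1. Qed.

Lemma leval_const m n (C : 'M[K]_(m, n)) a : leval (lconst C) a = C.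
Proof.
rewrite /leval (@fsum_int_single _ _ 0) /lconst ?eqxx ?expr0z ?scale1r //.
by move=> i hi; rewrite (negPf hi) scaler0.
Qed.

Lemma sigma_q_const q m n (C : 'M[K]_(m, n)) : sigma_q q (lconst C) = lconst C.
Proof.
apply/funext => k; rewrite /sigma_q /lconst; case: eqP => [->|_].
  by rewrite expr0z scale1r.
by rewrite scaler0.
Qed.

Lemma bounded_below_sigma q m n (F : laurent K m n) lo :
  bounded_below F lo -> bounded_below (sigma_q q F) lo.
Proof. by move=> hF k hk; rewrite /sigma_q hF ?scaler0. Qed.

Lemma sigma_qM q m n p (F : laurent K m n) (G : laurent K n p) lo lo' :
  q != 0 -> bounded_below F lo -> bounded_below G lo' ->
  sigma_q q (lmul F G) = lmul (sigma_q q F) (sigma_q q G).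
Proof.
move=> q0 hF hG; apply/funext => k.
pose N := (`|k| + `|lo| + `|lo'|).+1%N.
have hF' := @bounded_below_sigma q _ _ _ _ hF.
have hG' := @bounded_below_sigma q _ _ _ _ hG.
rewrite {1}/sigma_q (lmul_window (N := N) hF hG (lexx lo)); last by rewrite /N; lia.
rewrite (lmul_window (N := N) hF' hG' (lexx lo)); last by rewrite /N; lia.
rewrite scaler_sumr; apply: eq_bigr => t _; rewrite /sigma_q.
by rewrite -scalemxAl -scalemxAr scalerA -expfzDr //; congr (q ^ _ *: _); lia.
Qed.

Lemma convergent_bounded m n (F : laurent K m n) :
  convergent F -> exists lo, bounded_below F lo.
Proof. by case=> [[lo h] _]; exists lo. Qed.

Lemma convergent_finite m n (F : laurent K m n) lo (hi : nat) :
  bounded_below F lo -> (forall k : nat, (hi <= k)%N -> F k%:Z = 0) -> convergent F.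
Proof.
move=> hF hF'; split; first by exists lo.
exists 1 => [|i j]; first exact: oner_neq0.
apply/cvg_ex; exists (series (fun k : nat => F k%:Z i j * 1 ^+ k) hi).
apply: cvg_near_cst; exists hi => // k /= hk.
rewrite /series /= (big_cat_nat (n := hi)) //=.
have -> : \sum_(hi <= t < k) F t%:Z i j * 1 ^+ t = 0.
  rewrite big_nat_cond big1 // => t /andP[/andP[ht _] _].
  by rewrite hF' // mxE mul0r.
by rewrite addr0.
Qed.

Lemma convergent_const m n (C : 'M[K]_(m, n)) : convergent (lconst C).
Proof.
apply: (@convergent_finite _ _ _ 0 1); first exact: bounded_below_lconst.
by case.
Qed.

Lemma convergent_constM m n p (C : 'M[K]_(m, n)) (F : laurent K n p) :
  convergent F -> convergent (lmul (lconst C) F).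
Proof.
rewrite lmul_constl; case=> -[lo hlo] [z z0 hz]; split.
  by exists lo => k hk; rewrite hlo ?mulmx0.
exists z => // i j.
have -> : (fun k : nat => (C *m F k%:Z) i j * z ^+ k) =
   (fun k : nat => \sum_l C i l * (F k%:Z l j * z ^+ k)).
  by apply/funext => k; rewrite !mxE mulr_suml; apply: eq_bigr => l _; rewrite mulrA.
have -> : series (fun k : nat => \sum_l C i l * (F k%:Z l j * z ^+ k)) =
   (fun N => \sum_l C i l * series (fun k : nat => F k%:Z l j * z ^+ k) N).
  apply/funext => N; rewrite /series /= exchange_big /=; apply: eq_bigr => l _.
  by rewrite mulr_sumr.
elim: (index_enum _) => [|l s IH].
  under eq_fun do rewrite big_nil.
  exact: is_cvg_cst.
under eq_fun do rewrite big_cons.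
apply: is_cvgD IH; apply: is_cvgM; last exact: hz.
exact: is_cvg_cst.
Qed.

Lemma lmul_entry m n p (F : laurent K m n) (G : laurent K n p) lo lo' k i j :
  bounded_below F lo -> bounded_below G lo' ->
  lmul F G k i j = \sum_l \sum_(t \in [set: int]) F t i l * G (k - t) l j.
Proof.
move=> hF hG; pose N := (`|k| + `|lo| + `|lo'|).+1%N.
rewrite (lmul_window (N := N) hF hG (lexx lo)); last by rewrite /N; lia.
rewrite summxE; under eq_bigr do rewrite mxE.
rewrite exchange_big /=; apply: eq_bigr => l _.
rewrite (@fsum_int_window _ _ lo N) // => t ht.
have h1 : lo <= t.
  by rewrite leNgt; apply: contra ht => /hF ->; rewrite mxE mul0r.
have h2 : lo' <= k - t.
  by rewrite leNgt; apply: contra ht => /hG ->; rewrite mxE mulr0.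
by rewrite /N; lia.
Qed.

End Laurent.

(** * The slope filtration and the inverse of a normal form *)

Section SlopeFiltration.
Variables (R : nzRingType) (n : nat) (mu : 'I_n -> int).

(** The filtration by the distance above the diagonal blocks: index 0 gives the
    block triangular matrices and index 1 the strictly block triangular ones. *)
Definition slope_ge (s : int) (M : 'M[R]_n) : Prop :=
  forall i j, M i j != 0 -> s <= mu j - mu i.

Definition slope_proj (P : pred int) : 'M[R]_n :=
  \matrix_(i, j) ((i == j) && P (mu i))%:R.

Lemma slope_projMl P (M : 'M[R]_n) i j :
  (slope_proj P *m M) i j = if P (mu i) then M i j else 0.
Proof.
rewrite mxE (bigD1 i) //= big1 ?addr0 => [|k ki].
  by rewrite mxE eqxx /=; case: (P _); rewrite ?mul1r ?mul0r.
by rewrite mxE eq_sym (negPf ki) mul0r.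
Qed.

Lemma slope_projMr P (M : 'M[R]_n) i j :
  (M *m slope_proj P) i j = if P (mu j) then M i j else 0.
Proof.
rewrite mxE (bigD1 j) //= big1 ?addr0 => [|k ki].
  by rewrite mxE eqxx /=; case: (P _); rewrite ?mulr1 ?mulr0.
by rewrite mxE (negPf ki) mulr0.
Qed.

(** Block diagonal matrices as a commutant: this form is inherited by inverses
    and by everything else that commutes with what commutes with the matrix. *)
Lemma slope_blockP (M : 'M[R]_n) :
  (forall P, slope_proj P *m M = M *m slope_proj P) <->
  (forall i j, M i j != 0 -> mu i = mu j).
Proof.
split=> [h i j nz | h P].
  apply/esym/eqP; apply: contraNT nz => hij.
  have := congr1 (fun A : 'M[R]_n => A i j) (h (pred1 (mu i))).
  by rewrite slope_projMl slope_projMr /= eqxx (negPf hij) => ->.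
apply/matrixP => i j; rewrite slope_projMl slope_projMr.
have [->|/h ->//] := eqVneq (M i j) 0; by rewrite !if_same.
Qed.

Lemma slope_block_ge0 (M : 'M[R]_n) :
  (forall i j, M i j != 0 -> mu i = mu j) -> slope_ge 0 M.
Proof. by move=> h i j /h ->; rewrite subrr. Qed.

Lemma slope_ge0_zero s : slope_ge s 0.
Proof. by move=> i j; rewrite mxE eqxx. Qed.

Lemma slope_geD s M N : slope_ge s M -> slope_ge s N -> slope_ge s (M + N).
Proof.
move=> hM hN i j; rewrite mxE; have [->|/hM //] := eqVneq (M i j) 0.
by rewrite add0r => /hN.
Qed.

Lemma slope_geN s M : slope_ge s M -> slope_ge s (- M).
Proof. by move=> hM i j; rewrite mxE oppr_eq0 => /hM. Qed.

Lemma slope_geZ s x M : slope_ge s M -> slope_ge s (x *: M).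
Proof.
move=> hM i j; rewrite mxE => nz; apply: hM; apply: contraNneq nz => ->.
by rewrite mulr0.
Qed.

Lemma slope_geW s t M : t <= s -> slope_ge s M -> slope_ge t M.
Proof. by move=> ts hM i j /hM; apply: le_trans. Qed.

Lemma slope_geM s t M N : slope_ge s M -> slope_ge t N -> slope_ge (s + t) (M *m N).
Proof.
move=> hM hN i j; rewrite mxE => nz.
have [k] : exists k, M i k * N k j != 0.
  apply/existsP; apply: contraNT nz; rewrite negb_exists => /forallP h.
  by rewrite big1 // => k _; apply/eqP; have := h k; rewrite negbK.
have [->|/hM h1] := eqVneq (M i k) 0; first by rewrite mul0r eqxx.
have [->|/hN h2 _] := eqVneq (N k j) 0; first by rewrite mulr0 eqxx.
lia.
Qed.

Lemma slope_geX s M k : slope_ge s M -> slope_ge (s *+ k) (M ^+ k).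
Proof.
move=> hM; elim: k => [|k IH].
  by apply: slope_block_ge0 => i j; have [->//|ij] := eqVneq i j; rewrite mxE (negPf ij) eqxx.
by rewrite exprS mulrS; apply: slope_geM.
Qed.

Definition slope_range : nat := (\sum_i `|mu i|)%N.

Lemma slope_rangeP i : (`|mu i| <= slope_range)%N.
Proof. by rewrite /slope_range (bigD1 i) //= leq_addr. Qed.

Lemma slope_ge_large s M :
  (slope_range + slope_range)%:Z < s -> slope_ge s M -> M = 0.
Proof.
move=> hs hM; apply/matrixP => i j; rewrite mxE; apply/eqP.
apply: contraT => /hM; have := slope_rangeP i; have := slope_rangeP j; lia.
Qed.

(** The geometric series of [- M] stops, because [M] is nilpotent. *)
Lemma slope_ge1_unipotent M : slope_ge 1 M ->
  exists N, (1%:M + M) *m N = 1%:M.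
Proof.
move=> hM; pose T := (slope_range + slope_range).+1%N.
have h0 : (- M) ^+ T = 0.
  apply: (@slope_ge_large (1 *+ T)); last exact/slope_geX/slope_geN.
  by rewrite /T -[1 *+ _]/(_%:R) natz; lia.
exists (\sum_(i < T) (- M) ^+ i); have := subrX1 (- M) T.
rewrite h0 sub0r -opprD mulNr => /oppr_inj h.
by rewrite mulmxE [1%:M + M]addrC; apply/esym.
Qed.

End SlopeFiltration.

Lemma slope_block_inv (F : fieldType) n (mu : 'I_n -> int) (L : 'M[F]_n) :
  L \in unitmx -> (forall i j, L i j != 0 -> mu i = mu j) ->
  forall i j, invmx L i j != 0 -> mu i = mu j.
Proof.
move=> uL /slope_blockP h; apply/slope_blockP => m.
have := congr1 (fun A => invmx L *m A *m invmx L) (h m).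
by rewrite !mulmxA mulmxK // mulVmx // mul1mx.
Qed.

Section NormalFormGL.
Variable K : numClosedFieldType.

(** The extension by zero to negative indices turns the multiplication by a
    power of [z] into a shift of the index. *)
Definition pcoef (p : {poly K}) (z : int) : K := if z is Posz t then p`_t else 0.

Lemma pcoefM (p r : {poly K}) z :
  pcoef (p * r) z = \sum_(y \in [set: int]) pcoef p y * pcoef r (z - y).
Proof.
case: z => z; last first.
  rewrite /= fsbig1 // => y _; case: y => y; last by rewrite mul0r.
  have -> : Negz z - y%:Z = Negz (z + y) by rewrite !NegzE; lia.
  by rewrite mulr0.
rewrite /= coefM (@fsum_int_window _ _ 0 z.+1) => [|y].
  apply: eq_bigr => i _; rewrite add0r /=.
  by have -> : z%:Z - i%:Z = (z - i)%N%:Z by (have := ltn_ord i; lia).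
case: y => y; last by rewrite mul0r eqxx.
have [lt|ge] := ltnP z y; last by lia.
have -> : z%:Z - y%:Z = Negz (y - z).-1 by rewrite !NegzE; lia.
by rewrite mulr0 eqxx.
Qed.

Lemma pcoef_sum I (r : seq I) (F : I -> {poly K}) z :
  pcoef (\sum_(i <- r) F i) z = \sum_(i <- r) pcoef (F i) z.
Proof.
case: z => z /=; first exact: coef_sum.
by rewrite big1.
Qed.

Lemma pcoef_delta n (i j : 'I_n) (s k : int) :
  (i == j -> s = 0) -> pcoef ((1%:M : 'M[{poly K}]_n) i j) (k + s) =
  (@lone K n k) i j.
Proof.
rewrite /lone !mxE; case: (eqVneq i j) => [_ ->//|ij _]; last first.
  by rewrite mulr0n; case: (_ + _) => z //=; rewrite coef0.
rewrite addr0 mulr1n; case: k => k //=.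
by rewrite coef1.
Qed.

Variables (n : nat) (mu : 'I_n -> int) (N : laurent K n n).
Hypothesis hN : normal_form mu N.

Lemma normal_form_bounded : bounded_below N (- (slope_range mu)%:Z).
Proof.
move=> k hk; apply/matrixP => i j; rewrite mxE; apply/eqP; apply: contraT.
case: hN => _ h /h; have := slope_rangeP mu i; lia.
Qed.

Lemma lead_block i j : lead mu N i j != 0 -> mu i = mu j.
Proof. by rewrite mxE; case: (eqVneq (mu i) (mu j)); rewrite ?eqxx. Qed.

Let T := (slope_range mu + slope_range mu).+1%N.
Let Q : 'M[{poly K}]_n := \matrix_(i, j) \poly_(t < T) N (mu i + t%:Z) i j.

(** A normal form is [z^mu] times a polynomial matrix, [Q]: row [i] has no term
    below the degree [mu i]. *)
Lemma normal_form_pcoef k i j : N k i j = pcoef (Q i j) (k - mu i).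
Proof.
have [_ h] := hN; case E : (k - mu i) => [t|t] /=; last first.
  apply/eqP; apply: contraT => /h; lia.
rewrite mxE coef_poly; have -> : k = mu i + t%:Z by lia.
case: ltnP => // ht; apply/eqP; apply: contraT => /h.
have := slope_rangeP mu i; have := slope_rangeP mu j; rewrite /T in ht; lia.
Qed.

(** The polynomial matrix is [lead] plus a strictly block triangular matrix,
    that is, [lead] times a unipotent matrix. *)
Lemma normal_form_polyinv :
  exists Q' : 'M[{poly K}]_n, Q *m Q' = 1%:M /\ Q' *m Q = 1%:M.
Proof.
pose L := map_mx polyC (lead mu N); pose Li := map_mx polyC (invmx (lead mu N)).
have [uL hs] := hN.
have LLi : L *m Li = 1%:M by rewrite -map_mxM mulmxV // map_mx1.
have hLi : slope_ge mu 0 Li.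
  apply: slope_block_ge0 => i j; rewrite mxE polyC_eq0.
  by apply: slope_block_inv; [exact: uL | exact: lead_block].
have hU : slope_ge mu 1 (Q - L).
  move=> i j nz; have [lt|ge] := ltP (mu i) (mu j); first by lia.
  case/negP: nz; rewrite !mxE subr_eq0; apply/eqP/polyP => t.
  rewrite coef_poly coefC.
  case: t => [|t] /=; first last.
    case: ltnP => // _; apply/eqP; apply: contraT => /hs; lia.
  rewrite addr0; have [//|ij] := eqVneq (mu i) (mu j).
  by apply/eqP; apply: contraT => /hs; move/eqP: ij; lia.
have [V hV] : exists V, (1%:M + Li *m (Q - L)) *m V = 1%:M.
  by apply: (@slope_ge1_unipotent _ _ mu); rewrite -[1]add0r; apply: slope_geM.
exists (V *m Li); have h : Q *m (V *m Li) = 1%:M.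
  have -> : Q = L *m (1%:M + Li *m (Q - L)).
    by rewrite mulmxDr mulmx1 mulmxA LLi mul1mx addrC subrK.
  by rewrite -mulmxA (mulmxA _ V) hV mul1mx.
by split => //; apply: mulmx1C.
Qed.

(** If [N] is [z^mu Q] then [Q^-1 z^-mu] is an inverse of [N], and a Laurent
    polynomial. *)
Lemma normal_form_GL : is_GL N.
Proof.
have [Q' [h1 h2]] := normal_form_polyinv.
pose S := (\sum_i \sum_j size (Q' i j))%N.
have hS i j : (size (Q' i j) <= S)%N.
  by rewrite /S (bigD1 i) //= (bigD1 j) //= -addnA leq_addr.
pose G : laurent K n n := fun k => \matrix_(i, j) pcoef (Q' i j) (k + mu j).
have bN := normal_form_bounded.
have bG : bounded_below G (- (slope_range mu)%:Z).
  move=> k hk; apply/matrixP => i j; rewrite !mxE.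
  case E : (k + mu j) => [t|//]; have := slope_rangeP mu j; lia.
exists G; split.
- apply: (convergent_finite (hi := (slope_range mu).+1) bN) => k hk.
  apply/matrixP => i j; rewrite mxE; apply/eqP; apply: contraT.
  case: hN => _ h /h; have := slope_rangeP mu i; have := slope_rangeP mu j; lia.
- apply: (convergent_finite (hi := S + slope_range mu) bG) => k hk.
  apply/matrixP => i j; rewrite !mxE; have := slope_rangeP mu j.
  case E : (k%:Z + mu j) => [t|t] //= hj; apply: nth_default.
  apply: leq_trans (hS i j) _. clear -E hj hk; lia.
- apply/funext => k; apply/matrixP => i j; rewrite (lmul_entry k i j bN bG).
  rewrite -(@pcoef_delta n i j (mu j - mu i)); last by move/eqP->; rewrite subrr.
  rewrite -h1 mxE pcoef_sum; apply: eq_bigr => m _; rewrite pcoefM.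
  rewrite [RHS](@reindex_fsbigT _ _ _ _ _ (fun l : int => l - mu i)); last first.
    by exists (fun l => l + mu i) => x; rewrite ?subrK ?addrK.
  apply: eq_fsbigr => l _; rewrite normal_form_pcoef /G [X in _ * X]mxE; congr (_ * pcoef _ _); lia.
- apply/funext => k; apply/matrixP => i j; rewrite (lmul_entry k i j bG bN).
  rewrite -(@pcoef_delta n i j 0) // addr0.
  rewrite -h2 mxE pcoef_sum; apply: eq_bigr => m _; rewrite pcoefM.
  rewrite [RHS](@reindex_fsbigT _ _ _ _ _ (fun l : int => l + mu m)); last first.
    by exists (fun l => l - mu m) => x; rewrite ?subrK ?addrK.
  apply: eq_fsbigr => l _; rewrite normal_form_pcoef /G [X in X * _]mxE; congr (_ * pcoef _ _); lia.
Qed.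

End NormalFormGL.

(** * Elements of the Stokes Lie algebra are strictly triangular *)

Section NormalFormObjects.
Variables (K : numClosedFieldType) (q a : K).

Lemma lone_inverse n : is_inverse (@lone K n) (@lone K n).
Proof.
by split; rewrite ?lmul1l // lone_const; exact: convergent_const.
Qed.

Lemma lone_morphism n (A : laurent K n n) : is_morphism q A A (@lone K n).
Proof.
split; first by rewrite lone_const; exact: convergent_const.
by rewrite lmul1r {1}lone_const sigma_q_const -lone_const lmul1l.
Qed.

Definition nf_object n (mu : 'I_n -> int) (N : laurent K n n)
    (hN : normal_form mu N) : E1 q n :=
  MkE1 (normal_form_GL hN) hN (lone_inverse n) (lone_morphism N).

(** Erasing blocks leaves the slopes and the dimension unchanged.  Keeping the
    diagonal blocks gives the graded object; keeping in addition the rows of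
    slope at least [m] gives the quotient by the slopes below [m], padded by the
    graded pieces of these slopes. *)
Definition slope_mask n (mu : 'I_n -> int) (keep : rel int) (N : laurent K n n) :
    laurent K n n :=
  fun k => \matrix_(i, j) if keep (mu i) (mu j) then N k i j else 0.

Lemma slope_mask_nf n (mu : 'I_n -> int) (keep : rel int) (N : laurent K n n) :
  reflexive keep -> normal_form mu N -> normal_form mu (slope_mask mu keep N).
Proof.
move=> kk [uL h]; split.
  suff -> : lead mu (slope_mask mu keep N) = lead mu N by [].
  by apply/matrixP => i j; rewrite !mxE; case: eqP => // ->; rewrite kk.
by move=> k i j; rewrite mxE; case: ifP => _; [apply: h | rewrite eqxx].
Qed.

(** The isomorphism of [X] with its normal form is part of the definition of
    the fiber functor on [X], so that it disappears when the functor is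
    applied. *)
Lemma omega_toNF n (X : E1 q n) (N : laurent K n n) (hN : normal_form (slope X) N)
    (C : 'M[K]_n) :
  (forall i j, C i j != 0 -> slope X i = slope X j) ->
  omega a X (nf_object hN) (lmul (lconst C) (toNF X)) = C.
Proof.
move=> hC; rewrite /omega /= lmul1l.
have [/convergent_bounded [lo hlo] /convergent_bounded [lo' hlo'] hinv _] := toNF_inv X.
rewrite (lmulA (@bounded_below_lconst _ _ _ C) hlo hlo') hinv lmul1r.
rewrite -[RHS](leval_const C a); congr (leval _ a).
apply/funext => k; apply/matrixP => i j; rewrite mxE /lconst.
case: eqP => // /eqP ij; case: eqP => _; last by rewrite mxE.
by apply/esym/eqP; apply: contraNT ij => /hC ->.
Qed.

Lemma toNF_morphism n (X : E1 q n) (N : laurent K n n) (hN : normal_form (slope X) N)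
    (C : 'M[K]_n) :
  (forall k, C *m nform X k = N k *m C) ->
  E1_mor X (nf_object hN) (lmul (lconst C) (toNF X)).
Proof.
move=> hC; have [cT mT] := toNF_mor X.
have [/convergent_bounded [lo hlo] _ _ _] := toNF_inv X.
have [G [/convergent_bounded [la hla] _ _ _]] := sysmx_GL X.
have bT := @bounded_below_sigma _ q _ _ _ _ hlo.
have bC := @bounded_below_lconst _ _ _ C.
split; first exact: convergent_constM.
rewrite /=.
have -> : sigma_q q (lmul (lconst C) (toNF X)) = lmul (lconst C) (sigma_q q (toNF X)).
  rewrite !lmul_constl; apply/funext => k; by rewrite /sigma_q scalemxAr.
rewrite (lmulA bC bT hla) mT.
rewrite -(lmulA bC (normal_form_bounded (nformP X)) hlo).
rewrite -(lmulA (normal_form_bounded hN) bC hlo).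
congr (lmul _ _); rewrite lmul_constl lmul_constr.
by apply/funext => k; rewrite hC.
Qed.

Lemma omega_nf n (mu : 'I_n -> int) (N N' : laurent K n n) (hN : normal_form mu N)
    (hN' : normal_form mu N') (C : 'M[K]_n) :
  (forall i j, C i j != 0 -> mu i = mu j) ->
  omega a (nf_object hN) (nf_object hN') (lconst C) = C.
Proof.
by move=> hC; have := @omega_toNF _ (nf_object hN) _ hN' _ hC; rewrite /= lmul1r.
Qed.

Lemma nf_morphism n (mu : 'I_n -> int) (N N' : laurent K n n) (hN : normal_form mu N)
    (hN' : normal_form mu N') (C : 'M[K]_n) :
  (forall k, C *m N k = N' k *m C) ->
  E1_mor (nf_object hN) (nf_object hN') (lconst C).
Proof.
by move=> hC; have := @toNF_morphism _ (nf_object hN) _ hN' _ hC; rewrite /= lmul1r.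
Qed.

Lemma slope_proj_block n (mu : 'I_n -> int) P i j :
  slope_proj K mu P i j != 0 -> mu i = mu j.
Proof. by have [->//|ij] := eqVneq i j; rewrite mxE (negPf ij) eqxx. Qed.

(** Fix a slope [m], and let [X'] be the quotient of [X] by the slopes below
    [m], padded by graded pieces.  The projection [p] onto the slopes at least [m]
    is a morphism from [X] to [X'], and so is the
    inclusion [e] in [X'] of the piece of slope [m] of the graded object, which is
    pure.  As [D] vanishes on the latter, [p D(X) e = D(X') e = 0]: in a column of
    slope [m], all entries of [D(X)] in rows of slope at least [m] vanish. *)
Lemma st_slope_ge1 (D : fiber_endo q K) : st a D ->
  forall n (X : E1 q n), slope_ge (slope X) 1 (D n X).
Proof.
case/stP=> -[hmor _ _] hpure n X i0 j0 nz; rewrite leNgt; apply/negP => hlt.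
have hle : slope X j0 <= slope X i0 by lia.
case/negP: nz; apply/eqP; move: {hlt} hle => hle.
set mu := slope X in hle *; set m := mu j0 in hle *.
pose up : rel int := fun x y => (x == y) || (m <= x).
have hX : normal_form mu (nform X) := nformP X.
have hN' : normal_form mu (slope_mask mu up (nform X)).
  by apply: slope_mask_nf => // x; rewrite /up eqxx.
have hN0 : normal_form mu (slope_mask mu eq_op (nform X)) by apply: slope_mask_nf.
pose X' := nf_object hN'; pose X0 := nf_object hN0.
have X0pure : D n X0 = 0.
  apply: hpure; exists mu, (slope_mask mu eq_op (nform X)), (@lone K n); split=> //.
  - apply/funext => k; apply/matrixP => i j; rewrite !mxE.
    by case: (mu i == mu j).
  - by exists (@lone K n); exact: lone_inverse.
  - exact: lone_morphism.
pose p : 'M[K]_n := slope_proj K mu (fun x => m <= x).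
pose e : 'M[K]_n := slope_proj K mu (pred1 m).
have h1 : D n X' *m p = p *m D n X.
  have := hmor _ _ X X' _ (@toNF_morphism _ X _ hN' p _).
  rewrite omega_toNF; last exact: slope_proj_block.
  apply=> k; apply/matrixP => i j; rewrite slope_projMl slope_projMr mxE /up -/mu.
  have [_ hNF] := hX; have [->|/hNF] := eqVneq (nform X k i j) 0.
    by rewrite !if_same.
  case=> [[<- _]|[h h']]; first by rewrite eqxx.
  have -> : (mu i == mu j) = false by apply/eqP; lia.
  case: (leP m (mu i)) => h2 /=; last by rewrite if_same.
  by rewrite (le_trans h2) //; lia.
have h2 : D n X' *m e = 0.
  have := hmor _ _ X0 X' _ (@nf_morphism _ mu _ _ hN0 hN' e _).
  rewrite omega_nf; last exact: slope_proj_block.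
  rewrite X0pure mulmx0; apply=> k; apply/matrixP => i j.
  rewrite slope_projMl slope_projMr !mxE /up /=.
  have [_ hNF] := hX; have [->|/hNF] := eqVneq (nform X k i j) 0.
    by rewrite !if_same.
  case=> [[<- _]|[h h']]; first by rewrite eqxx.
  have -> : (mu i == mu j) = false by apply/eqP; lia.
  rewrite if_same; case: eqP => // jm /=.
  by case: leP => // h3; lia.
have h3 : p *m D n X *m e = 0.
  rewrite -h1 -mulmxA; have -> : p *m e = e; last exact: h2.
  apply/matrixP => i j; rewrite slope_projMl; case: ifP => // lt.
  by rewrite mxE /=; case: (eqVneq (mu i)) lt => [->|_]; rewrite ?lexx // andbF.
have := congr1 (fun M : 'M[K]_n => M i0 j0) h3.
by rewrite slope_projMr slope_projMl mxE /= eqxx hle.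
Qed.

End NormalFormObjects.

(** * Morphisms between normal forms *)

Section MorphismsOfNormalForms.
Variables (K : numClosedFieldType) (q : K).
Hypothesis q0 : q != 0.

Section Blocks.
Variables (n p : nat) (mu : 'I_n -> int) (nu : 'I_p -> int).
Variables (A : laurent K n n) (B : laurent K p p) (H : laurent K p n) (lo : int).
Hypotheses (hA : normal_form mu A) (hB : normal_form nu B).
Hypotheses (hH : bounded_below H lo) (morH : lmul (sigma_q q H) A = lmul B H).

Definition slope_diag (s k : int) : 'M[K]_(p, n) :=
  \matrix_(i, j) if nu i - mu j == s then H k i j else 0.

(** An off-diagonal entry of [A] or [B] raises the slope, so in the equation
    [H(qz) A = B H] it meets an entry of [H] whose slope difference exceeds [s].
    When these vanish, only the diagonal blocks of [A] and [B] remain.  They have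
    the degrees [mu j] and [nu i], which differ by [s]. *)
Lemma slope_diag_eq s l :
  (forall k i j, s < nu i - mu j -> H k i j = 0) ->
  q ^ l *: (slope_diag s l *m lead mu A) = lead nu B *m slope_diag s (l - s).
Proof.
move=> hs; apply/matrixP => i j; rewrite !mxE.
have [ij|ij] := eqVneq (nu i - mu j) s; last first.
  rewrite !big1 ?mulr0 // => m _.
    rewrite !mxE; have [nm|] := eqVneq (nu i) (nu m); last by rewrite mul0r.
    by rewrite -nm (negPf ij) mulr0.
  rewrite !mxE; have [nm|] := eqVneq (mu m) (mu j); last by rewrite mulr0.
  by rewrite nm (negPf ij) mul0r.
have := congr1 (fun F : laurent K p n => F (l + mu j) i j) morH.
rewrite (lmul_entry _ _ _ (@bounded_below_sigma _ q _ _ _ _ hH) (normal_form_bounded hA)).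
rewrite (lmul_entry _ _ _ (normal_form_bounded hB) hH) => eqij.
have [_ nfA] := hA; have [_ nfB] := hB.
transitivity (\sum_m \sum_(t \in [set: int]) sigma_q q H t i m * A (l + mu j - t) m j).
  rewrite mulr_sumr; apply: eq_bigr => m _; rewrite (@fsum_int_single _ _ l).
    rewrite /sigma_q !mxE mulrA; have [nm|nm] := eqVneq (mu m) (mu j).
      rewrite nm ij eqxx; congr (_ * A _ _ _); lia.
    rewrite mulr0; have [->|/nfA] := eqVneq (A (l + mu j - l) m j) 0; first by rewrite mulr0.
    by move/eqP in nm; lia.
  move=> t tl; have [->|/nfA] := eqVneq (A (l + mu j - t) m j) 0; first by rewrite mulr0.
  rewrite /sigma_q mxE => h; rewrite hs ?mulr0 ?mul0r //; lia.
rewrite eqij; apply: eq_bigr => m _; rewrite (@fsum_int_single _ _ (nu i)).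
  rewrite !mxE; have [nm|nm] := eqVneq (nu i) (nu m).
    rewrite -nm ij eqxx; congr (_ * H _ _ _); lia.
  rewrite mul0r; have [->|/nfB] := eqVneq (B (nu i) i m) 0; first by rewrite mul0r.
  move=> h; rewrite hs ?mulr0 //; move/eqP in nm; lia.
move=> t tl; have [->|/nfB] := eqVneq (B t i m) 0; first by rewrite mul0r.
move=> h; rewrite hs ?mulr0 //; lia.
Qed.

(** By descending induction on the slope difference [s], the equation of
    [slope_diag_eq] holds for all the coefficients.  As [s > 0] it determines
    each coefficient by an earlier one, and there are none before [lo]. *)
Lemma nf_morphism_upper k i j : 0 < nu i - mu j -> H k i j = 0.
Proof.
pose r : int := (slope_range mu + slope_range nu)%:Z.
suff h d : forall k i j, 0 < nu i - mu j -> r - d%:Z < nu i - mu j -> H k i j = 0.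
  move=> hij; apply: (h `|r|.+1%N) => //; lia.
elim: d => {k i j} [|d IH] k i j h0 hr.
  have := slope_rangeP mu j; have := slope_rangeP nu i; rewrite /r in hr; lia.
set s := nu i - mu j in h0 hr.
have IHs k' i' j' : s < nu i' - mu j' -> H k' i' j' = 0.
  by move=> h; apply: IH; lia.
suff h e : forall l, l < lo + e%:Z -> slope_diag s l = 0.
  have := congr1 (fun M : 'M[K]_(p, n) => M i j) (h `|k - lo|.+1%N k ltac:(lia)).
  by rewrite !mxE eqxx.
elim: e => [|e IHe] l hl.
  by apply/matrixP => i' j'; rewrite !mxE hH ?mxE ?if_same //; lia.
have [uA _] := hA.
have := slope_diag_eq l IHs; rewrite (IHe (l - s)); last by lia.
rewrite mulmx0 => /eqP; rewrite scaler_eq0 expfz_eq0 (negPf q0) andbF /= => /eqP h.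
by rewrite -(mulmxK uA (slope_diag s l)) h mul0mx.
Qed.

Lemma gr_part_intertwines l :
  q ^ l *: (gr_part mu nu H l *m lead mu A) = lead nu B *m gr_part mu nu H l.
Proof.
have -> : gr_part mu nu H l = slope_diag 0 l.
  by apply/matrixP => i j; rewrite !mxE subr_eq0.
by rewrite slope_diag_eq ?subr0 // => k i j; apply: nf_morphism_upper.
Qed.

End Blocks.

Variable a : K.

(** The [G k] are the coefficients of the graded part of [F].  The last clause
    says that [G k] maps the generalized eigenspace of [leadmx X] for [x] to that
    of [leadmx Y] for [q^k x]: the fiber functor does not respect the eigenvalues
    but only their classes modulo the powers of [q]. *)
Lemma omega_decomp n p (X : E1 q n) (Y : E1 q p) (F : laurent K p n) :
  E1_mor X Y F ->
  exists (s : seq int) (G : int -> 'M[K]_(p, n)),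
    [/\ omega a X Y F = \sum_(k <- s) a ^ k *: G k,
        forall k i j, G k i j != 0 -> slope Y i = slope X j &
        forall k, q ^ k *: (G k *m leadmx X) = leadmx Y *m G k].
Proof.
case=> [/convergent_bounded [f hf] morF].
have [/convergent_bounded [tx hTX] /convergent_bounded [tx' hTX'] invX1 invX2] := toNF_inv X.
have [/convergent_bounded [ty hTY] _ _ _] := toNF_inv Y.
have [_ morTX] := toNF_mor X; have [_ morTY] := toNF_mor Y.
have [GX [/convergent_bounded [x hX] _ _ _]] := sysmx_GL X.
have [GY [/convergent_bounded [y hY] _ _ _]] := sysmx_GL Y.
have hNX := normal_form_bounded (nformP X).
have hNY := normal_form_bounded (nformP Y).
have sig := @bounded_below_sigma K q.
have hTF := bounded_below_lmul hTY hf.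
pose H := lmul (lmul (toNF Y) F) (ofNF X).
have hH : bounded_below H _ := bounded_below_lmul hTF hTX'.
(* The inverse of [toNF X] is a morphism too. *)
have ofX : lmul (sigma_q q (ofNF X)) (nform X) = lmul (sysmx X) (ofNF X).
  rewrite -[nform X]lmul1r -invX1 -(lmulA hNX hTX hTX') -morTX.
  rewrite (lmulA (sig _ _ _ _ hTX) hX hTX').
  rewrite -(lmulA (sig _ _ _ _ hTX') (sig _ _ _ _ hTX) (bounded_below_lmul hX hTX')).
  rewrite -(sigma_qM q0 hTX' hTX) invX2 lone_const sigma_q_const -lone_const.
  by rewrite lmul1l.
have morH : lmul (sigma_q q H) (nform X) = lmul (nform Y) H.
  rewrite /H (sigma_qM q0 hTF hTX') (sigma_qM q0 hTY hf).
  rewrite (lmulA (bounded_below_lmul (sig _ _ _ _ hTY) (sig _ _ _ _ hf)) (sig _ _ _ _ hTX') hNX).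
  rewrite ofX -(lmulA (bounded_below_lmul (sig _ _ _ _ hTY) (sig _ _ _ _ hf)) hX hTX').
  rewrite (lmulA (sig _ _ _ _ hTY) (sig _ _ _ _ hf) hX) morF.
  rewrite -(lmulA (sig _ _ _ _ hTY) hY hf) morTY.
  by rewrite (lmulA hNY hTY hf) (lmulA hNY hTF hTX').
have [s hs] := fsum_int_seq (fun k => a ^ k *: gr_part (slope X) (slope Y) H k).
exists s, (gr_part (slope X) (slope Y) H); split; first exact: hs.
  move=> k i j; have [//|ij] := eqVneq (slope Y i) (slope X j).
  by rewrite mxE (negPf ij) eqxx.
move=> k; exact: (gr_part_intertwines (nformP X) (nformP Y) hH morH).
Qed.

End MorphismsOfNormalForms.

(** * Weight components of a matrix *)

Section Components.
Variables (K : numClosedFieldType) (q : K).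

(** Rows that are generalized eigenvectors of [A_0] in the block of slope
    [g.1], and columns in the next definition.  The exponent is left free because
    morphisms relate objects of different dimensions. *)
Definition left_geig n (X : E1 q n) (g : int * K) r (U : 'M[K]_(r, n)) : Prop :=
  (forall i j, U i j != 0 -> slope X j = g.1) /\
  exists N, U *m (leadmx X - g.2%:M) ^+ N = 0.

Definition right_geig n (X : E1 q n) (g : int * K) r (V : 'M[K]_(n, r)) : Prop :=
  (forall i j, V i j != 0 -> slope X i = g.1) /\
  exists N, (leadmx X - g.2%:M) ^+ N *m V = 0.

Lemma leadmx_unit n (X : E1 q n) : leadmx X \in unitmx.
Proof. by case: (nformP X). Qed.

Lemma left_right_orth n (X : E1 q n) g h r s (U : 'M[K]_(r, n)) (V : 'M[K]_(n, s)) :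
  left_geig X g U -> right_geig X h V -> g != h -> U *m V = 0.
Proof.
case: g => m x; case: h => m' y [hU [N hN]] [hV [N' hN']] gh /=.
have [xy|xy] := eqVneq x y; last exact: generalized_eigen_orth xy hN hN'.
apply/matrixP => i j; rewrite !mxE big1 // => k _.
have [->|/hU /= hk] := eqVneq (U i k) 0; first by rewrite mul0r.
have [->|/hV /= hk'] := eqVneq (V k j) 0; first by rewrite mulr0.
by case/negP: gh; rewrite xpair_eqE -hk -hk' xy !eqxx.
Qed.

Lemma left_geig_neq0 n (X : E1 q n) g r (U : 'M[K]_(r, n)) :
  left_geig X g U -> U != 0 -> g.2 != 0.
Proof.
case=> _ [N hN]; apply: contraNneq => g0; move: hN; rewrite g0 raddf0 subr0 => hN.
have uN : leadmx X ^+ N \in unitmx.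
  elim: {hN} N => [|N IH]; first exact: unitmx1.
  by rewrite exprS -mulmxE unitmx_mul leadmx_unit.
by rewrite -(mulmxK uN U) hN mul0mx.
Qed.

(** As [leadmx X] is block diagonal, its spectral projectors commute with the
    projectors on the slopes. *)
Lemma graded_partition n (X : E1 q n) :
  exists (I : finType) (g : I -> int * K) (p : I -> 'M[K]_n),
    [/\ \sum_i p i = 1%:M, forall i, left_geig X (g i) (p i),
        forall i, right_geig X (g i) (p i) &
        forall i, (leadmx X - (g i).2%:M) ^+ n *m p i = 0].
Proof.
have [r [e [p [p1 hp]]]] := spectral_partition (leadmx X).
pose slopes := undup (codom (slope X)).
pose P (i : 'I_(size slopes)) : 'M[K]_n := slope_proj K (slope X) (pred1 slopes`_i).
have P1 : \sum_i P i = 1%:M.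
  apply/matrixP => i j; rewrite summxE !mxE.
  under eq_bigr do rewrite mxE.
  have [_|ij] := eqVneq i j; last by rewrite big1.
  have hi : slope X i \in slopes by rewrite mem_undup codom_f.
  have hlt : (index (slope X i) slopes < size slopes)%N by rewrite index_mem.
  rewrite (bigD1 (Ordinal hlt)) //= nth_index // eqxx big1 ?addr0 //.
  move=> k nk; case: eqP => //= hk; case/eqP: nk; apply: val_inj => /=.
  by rewrite hk index_uniq // undup_uniq.
have comm i k : P i *m p k = p k *m P i.
  have [_ _ hc] := hp k; apply/esym/hc/esym.
  by apply: (proj2 (slope_blockP (slope X) _)) => i' j'; exact: lead_block.
exists ('I_(size slopes) * 'I_r)%type, (fun ik : 'I_(size slopes) * 'I_r => (slopes`_ik.1, e ik.2)),
  (fun ik => P ik.1 *m p ik.2).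
have c2 i k : (leadmx X - (e k)%:M) ^+ n *m (P i *m p k) = 0.
  by have [hz _ _] := hp k; rewrite comm mulmxA hz mul0mx.
split.
- rewrite -(pair_bigA _ (fun i k => P i *m p k)) /=.
  under eq_bigr do rewrite -mulmx_sumr p1 mulmx1.
  exact: P1.
- case=> i k; split=> [i' j'|] /=.
    rewrite comm slope_projMr /=.
    by case: (slope X j' =P _) => // _; rewrite eqxx.
  by exists n; have [_ hz _] := hp k; rewrite -mulmxA hz mulmx0.
- case=> i k; split=> [i' j'|] /=.
    rewrite slope_projMl /=.
    by case: (slope X i' =P _) => // _; rewrite eqxx.
  by exists n; apply: c2.
- case=> i k /=; exact: c2.
Qed.

(** The weight of a matrix that maps the columns of index [h] to the rows of
    index [g]. *)
Definition wt_rel (d : nat) (c : set K) (g h : int * K) : bool :=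
  (h.1 - g.1 == d%:Z) && `[< c (g.2 / h.2) >].

(** The component is characterised by its values on generalized eigenvectors
    on both sides.  This makes no reference to a choice of projectors, and the
    compatibility with morphisms and tensor products becomes a computation with
    test vectors. *)
Definition is_wt_part n (X : E1 q n) d c (M N : 'M[K]_n) : Prop :=
  forall g h r s (U : 'M[K]_(r, n)) (V : 'M[K]_(n, s)),
    left_geig X g U -> right_geig X h V ->
    U *m N *m V = (wt_rel d c g h)%:R *: (U *m M *m V).

Definition wt_part n (X : E1 q n) d c (M : 'M[K]_n) : 'M[K]_n :=
  xget 0 [set N | is_wt_part X d c M N].

Lemma sandwich n p (I J : finType) (P : I -> 'M[K]_p) (Q : J -> 'M[K]_n)
    (M : 'M[K]_(p, n)) :
  \sum_i P i = 1%:M -> \sum_j Q j = 1%:M -> M = \sum_i \sum_j P i *m M *m Q j.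
Proof.
move=> P1 Q1; under eq_bigr do rewrite -mulmx_sumr Q1 mulmx1.
by rewrite -mulmx_suml P1 mul1mx.
Qed.

Lemma sandwich_eq n p (I J : finType) (P : I -> 'M[K]_p) (Q : J -> 'M[K]_n)
    (M N : 'M[K]_(p, n)) :
  \sum_i P i = 1%:M -> \sum_j Q j = 1%:M ->
  (forall i j, P i *m M *m Q j = P i *m N *m Q j) -> M = N.
Proof.
move=> P1 Q1 h; rewrite (sandwich M P1 Q1) (sandwich N P1 Q1).
by apply: eq_bigr => i _; apply: eq_bigr => j _.
Qed.

(** The projectors of a partition may be inserted freely between test vectors:
    those of another index contribute nothing, by orthogonality. *)
Lemma wt_part_explicit n (X : E1 q n) d c (M : 'M[K]_n)
    (I : finType) (g : I -> int * K) (p : I -> 'M[K]_n) :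
  \sum_i p i = 1%:M -> (forall i, left_geig X (g i) (p i)) ->
  (forall i, right_geig X (g i) (p i)) ->
  is_wt_part X d c M (\sum_i \sum_j (wt_rel d c (g i) (g j))%:R *: (p i *m M *m p j)).
Proof.
move=> p1 lp rp g0 h0 r s U V hU hV.
rewrite mulmx_sumr mulmx_suml.
have -> : U *m M *m V = \sum_i \sum_j U *m (p i *m M *m p j) *m V.
  rewrite {1}(sandwich M p1 p1) mulmx_sumr mulmx_suml; apply: eq_bigr => i _.
  by rewrite mulmx_sumr mulmx_suml.
rewrite scaler_sumr; apply: eq_bigr => i _; rewrite mulmx_sumr mulmx_suml scaler_sumr.
apply: eq_bigr => j _; rewrite -scalemxAr -scalemxAl !mulmxA.
have [<-|gi] := eqVneq g0 (g i); last first.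
  by rewrite (left_right_orth hU (rp i) gi) !mul0mx !scaler0.
have [<-//|gj] := eqVneq (g j) h0.
by rewrite -!mulmxA (left_right_orth (lp j) hV gj) !mulmx0 !scaler0.
Qed.

Lemma wt_partP n (X : E1 q n) d c M : is_wt_part X d c M (wt_part X d c M).
Proof.
apply: (@xgetPex _ 0 [set N | is_wt_part X d c M N]).
have [I [g [p [p1 lp rp _]]]] := graded_partition X.
by eexists; exact: wt_part_explicit p1 lp rp.
Qed.

Lemma wt_partE n (X : E1 q n) d c M g h r s (U : 'M[K]_(r, n)) (V : 'M[K]_(n, s)) :
  left_geig X g U -> right_geig X h V ->
  U *m wt_part X d c M *m V = (wt_rel d c g h)%:R *: (U *m M *m V).
Proof. exact: wt_partP. Qed.

Lemma wt_part_unique n (X : E1 q n) d c M N N' :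
  is_wt_part X d c M N -> is_wt_part X d c M N' -> N = N'.
Proof.
move=> h h'; have [I [g [p [p1 lp rp _]]]] := graded_partition X.
by apply: (sandwich_eq p1 p1) => i j; rewrite (h _ _ _ _ _ _ (lp i) (rp j))
  (h' _ _ _ _ _ _ (lp i) (rp j)).
Qed.

Lemma wt_part0 n (X : E1 q n) d c : wt_part X d c 0 = 0.
Proof.
apply: wt_part_unique; first exact: wt_partP.
by move=> g h r s U V _ _; rewrite mulmx0 mul0mx scaler0.
Qed.

Lemma wt_part_gwt n (X : E1 q n) d c M : gwt X d c (wt_part X d c M).
Proof.
have [I [g [p [p1 lp rp pn]]]] := graded_partition X.
have -> := wt_part_unique (@wt_partP n X d c M) (@wt_part_explicit n X d c M _ _ _ p1 lp rp).
split.
  move=> i j; rewrite summxE => nz.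
  have [k /=] : exists k, (\sum_l (wt_rel d c (g k) (g l))%:R *: (p k *m M *m p l)) i j != 0.
    apply/existsP; apply: contraNT nz; rewrite negb_exists => /forallP h.
    by rewrite big1 // => k _; apply/eqP; have := h k; rewrite negbK.
  rewrite summxE => {}nz.
  have [l /=] : exists l, ((wt_rel d c (g k) (g l))%:R *: (p k *m M *m p l)) i j != 0.
    apply/existsP; apply: contraNT nz; rewrite negb_exists => /forallP h.
    by rewrite big1 // => l _; apply/eqP; have := h l; rewrite negbK.
  rewrite mxE; case E : (wt_rel _ _ _ _); last by rewrite mul0r eqxx.
  rewrite mul1r => {}nz; case/andP: E => /eqP <- _.
  have -> : slope X i = (g k).1.
    apply/eqP; apply: contraNT nz => hne; rewrite -mulmxA mxE big1 // => t _.
    have [->|/(proj1 (rp k)) e] := eqVneq (p k i t) 0; first by rewrite mul0r.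
    by rewrite e eqxx in hne.
  have -> // : slope X j = (g l).1.
  apply/eqP; apply: contraNT nz => hne; rewrite mxE big1 // => t _.
  have [->|/(proj1 (lp l)) e] := eqVneq (p l t j) 0; first by rewrite mulr0.
  by rewrite e eqxx in hne.
move=> m e v [hv1 hv2].
have rv : right_geig X (m, e) v.
  split; last by exists n.
  move=> i j nz /=; apply/eqP; apply: contraNT nz => /hv1.
  by rewrite (ord1 j) => ->.
pose A := [set kl : I * I | (g kl.2 == (m, e)) && wt_rel d c (g kl.1) (g kl.2)]%SET.
exists #|A|, (fun t => (g (enum_val t).1).2),
  (fun t => p (enum_val t).1 *m M *m p (enum_val t).2 *m v); split.
  move=> t; have := enum_valP t; set kl := enum_val t; rewrite inE.
  case/andP=> /eqP gl /andP[/eqP]; rewrite gl /= => h1 /asboolP h2; split=> //.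
  split.
    move=> i hi; rewrite -!mulmxA mxE big1 // => s _.
    have [->|/(proj1 (rp kl.1)) e'] := eqVneq (p kl.1 i s) 0; first by rewrite mul0r.
    by case/eqP: hi; rewrite e' -h1; lia.
  by rewrite -!mulmxA mulmxA pn mul0mx.
rewrite mulmx_suml; under eq_bigr do rewrite mulmx_suml.
rewrite (pair_bigA _ (fun k l => (wt_rel d c (g k) (g l))%:R *: (p k *m M *m p l) *m v)) /=.
transitivity (\sum_(kl in A) p kl.1 *m M *m p kl.2 *m v); last by rewrite big_enum_val.
rewrite [RHS]big_mkcond /=.
apply: eq_bigr => -[k l] _ /=; rewrite inE /= -scalemxAl.
have [gl|gl] := eqVneq (g l) (m, e); last first.
  by rewrite -mulmxA (left_right_orth (lp l) rv gl) mulmx0 scaler0.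
by case: (wt_rel _ _ _ _); rewrite /= ?scale1r ?scale0r.
Qed.

End Components.

(** * Weight components of an element of the Stokes Lie algebra *)

Section TwistedPowers.
Variables (K : fieldType).

(** An intertwiner up to the factor [t] maps generalized eigenvectors for [x]
    to generalized eigenvectors for [t x]. *)
Lemma twisted_pow p n (A : 'M[K]_n) (B : 'M[K]_p) (G : 'M[K]_(p, n)) t x N :
  B *m G = t *: (G *m A) ->
  (B - (t * x)%:M) ^+ N *m G = t ^+ N *: (G *m (A - x%:M) ^+ N).
Proof.
move=> h; elim: N => [|N IH]; first by rewrite !expr0 scale1r mulmx1 mul1mx.
have h1 : (B - (t * x)%:M) *m G = t *: (G *m (A - x%:M)).
  by rewrite mulmxBl mulmxBr h scalerBr mul_scalar_mx mul_mx_scalar scalerA.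
rewrite exprS -mulmxE -mulmxA IH -scalemxAr mulmxA h1 -scalemxAl scalerA -mulmxA.
by rewrite exprSr mulmxE -exprS.
Qed.

End TwistedPowers.

Section TensorGeneralized.
Variables (F : fieldType) (m n : nat) (A : 'M[F]_m) (B : 'M[F]_n) (x y : F).

Lemma tens_sub_scalar :
  tensmx A B - (x * y)%:M = tensmx (A - x%:M) B + x *: tensmx 1%:M (B - y%:M).
Proof.
have -> : (x * y)%:M = x *: (y *: tensmx 1%:M 1%:M) :> 'M[F]_(m * n).
  by rewrite tensmx11 scalerA scalemx1.
apply/matrixP => i j; rewrite !mxE -[x *+ _]mulr_natr -[y *+ _]mulr_natr.
move: (A _ _) (B _ _) (_ == _)%:R (_ == _)%:R => u v w z.
ring.
Qed.

(** By [tens_sub_scalar], a factor [A (x) B - x y] lowers one of the two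
    exponents. *)
Lemma tens_left_geig k N N' r s (U : 'M[F]_(r, m)) (V : 'M[F]_(s, n)) :
  (N + N' <= k)%N -> U *m (A - x%:M) ^+ N = 0 -> V *m (B - y%:M) ^+ N' = 0 ->
  tensmx U V *m (tensmx A B - (x * y)%:M) ^+ k = 0.
Proof.
elim: k N N' U V => [|k IH] N N' U V le hU hV.
  move: le hU; rewrite leqn0 addn_eq0 => /andP[/eqP -> _]; rewrite expr0 mulmx1 => ->.
  by rewrite tens0mx mul0mx.
case: N le hU => [|N] le hU.
  by move: hU; rewrite expr0 mulmx1 => ->; rewrite tens0mx mul0mx.
case: N' le hV => [|N'] le hV.
  by move: hV; rewrite expr0 mulmx1 => ->; rewrite tensmx0 mul0mx.
rewrite exprS -mulmxE mulmxA {1}tens_sub_scalar mulmxDr -scalemxAr !tensmx_mul.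
rewrite mulmxDl -scalemxAl (IH N N'.+1); first last.
- have cB : (B - y%:M) ^+ N'.+1 *m B = B *m (B - y%:M) ^+ N'.+1.
    rewrite mulmxE; apply/esym/commrX/commrB => //; exact: comm_mx_scalar.
  by rewrite -mulmxA -cB mulmxA hV mul0mx.
- by rewrite -mulmxA mulmxE -exprS.
- by rewrite addSn ltnS in le.
rewrite add0r (IH N.+1 N'); first by rewrite scaler0.
- by rewrite addnS ltnS in le.
- by rewrite mulmx1.
- by rewrite -mulmxA mulmxE -exprS.
Qed.

Lemma tens_right_geig k N N' r s (U : 'M[F]_(m, r)) (V : 'M[F]_(n, s)) :
  (N + N' <= k)%N -> (A - x%:M) ^+ N *m U = 0 -> (B - y%:M) ^+ N' *m V = 0 ->
  (tensmx A B - (x * y)%:M) ^+ k *m tensmx U V = 0.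
Proof.
elim: k N N' U V => [|k IH] N N' U V le hU hV.
  move: le hU; rewrite leqn0 addn_eq0 => /andP[/eqP -> _]; rewrite expr0 mul1mx => ->.
  by rewrite tens0mx mulmx0.
case: N le hU => [|N] le hU.
  by move: hU; rewrite expr0 mul1mx => ->; rewrite tens0mx mulmx0.
case: N' le hV => [|N'] le hV.
  by move: hV; rewrite expr0 mul1mx => ->; rewrite tensmx0 mulmx0.
rewrite exprSr -mulmxE -mulmxA {2}tens_sub_scalar mulmxDl -scalemxAl !tensmx_mul.
rewrite mulmxDr -scalemxAr (IH N N'.+1); first last.
- have cB : (B - y%:M) ^+ N'.+1 *m B = B *m (B - y%:M) ^+ N'.+1.
    rewrite mulmxE; apply/esym/commrX/commrB => //; exact: comm_mx_scalar.
  by rewrite mulmxA cB -mulmxA hV mulmx0.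
- by rewrite mulmxA mulmxE -exprSr.
- by rewrite addSn ltnS in le.
rewrite add0r (IH N.+1 N'); first by rewrite scaler0.
- by rewrite addnS ltnS in le.
- by rewrite mul1mx.
- by rewrite mulmxA mulmxE -exprSr.
Qed.

End TensorGeneralized.

Section StWeight.
Variables (K : numClosedFieldType) (q a : K).
Hypothesis q0 : q != 0.

Lemma wt_rel_shift d c m m' x y k : Ell q c ->
  wt_rel d c (m, x) (m', q ^ k * y) = wt_rel d c (m, x) (m', y).
Proof.
case=> c0 _ ->; rewrite /wt_rel /=; congr (_ && _); apply: asbool_equiv_eq.
have qk : q ^ k != 0 by rewrite expfz_neq0.
have E : x / (q ^ k * y) = x / y * (q ^ k)^-1 by rewrite invfM mulrA mulrAC.
rewrite E; split=> -[l e].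
  by exists (l + k); rewrite expfzDr // mulrA -e -mulrA mulVf // mulr1.
by exists (l - k); rewrite e expfzDr // mulrA invr_expz.
Qed.

Lemma lkron_entry m n p r (F : laurent K m n) (G : laurent K p r) lo lo' k i1 i2 j1 j2 :
  bounded_below F lo -> bounded_below G lo' ->
  lkron F G k (mxtens_index (i1, i2)) (mxtens_index (j1, j2)) =
  \sum_(t \in [set: int]) F t i1 j1 * G (k - t) i2 j2.
Proof.
move=> hF hG; pose N := (`|k| + `|lo| + `|lo'|).+1%N.
rewrite /lkron (@fsum_int_window _ _ lo N); last first.
  move=> t ht.
  have h1 : lo <= t.
    by rewrite leNgt; apply: contra ht => /hF ->; rewrite tens0mx.
  have h2 : lo' <= k - t.
    by rewrite leNgt; apply: contra ht => /hG ->; rewrite tensmx0.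
  by rewrite /N; lia.
rewrite summxE; under eq_bigr do rewrite tensmxE.
rewrite (@fsum_int_window _ _ lo N) // => t ht.
have h1 : lo <= t.
  by rewrite leNgt; apply: contra ht => /hF ->; rewrite mxE mul0r.
have h2 : lo' <= k - t.
  by rewrite leNgt; apply: contra ht => /hG ->; rewrite mxE mulr0.
by rewrite /N; lia.
Qed.

(** The entries of a normal form start in the degree given by the slope of the
    row, so a coefficient of that lowest degree in the product comes from the
    lowest coefficients of both factors. *)
Lemma leadmx_tens m n (X : E1 q m) (Y : E1 q n) (Z : E1 q (m * n)) :
  is_tensor X Y Z -> leadmx Z = tensmx (leadmx X) (leadmx Y).
Proof.
case=> _ hs hn _; apply/matrixP => i j.
case: (mxtens_indexP i) => i1 i2; case: (mxtens_indexP j) => j1 j2.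
rewrite tensmxE !mxE !hs hn !mxtens_indexK /=.
have hX := normal_form_bounded (nformP X); have hY := normal_form_bounded (nformP Y).
have [_ nX] := nformP X; have [_ nY] := nformP Y.
rewrite (lkron_entry _ _ _ _ _ hX hY).
case: (eqVneq (slope X i1 + slope Y i2)) => [e|ne]; last first.
  have [e1|_] := eqVneq (slope X i1); last by rewrite mul0r.
  have [e2|_] := eqVneq (slope Y i2); last by rewrite mulr0.
  by case/eqP: ne; rewrite e1 e2.
rewrite (@fsum_int_single _ _ (slope X i1)) => [|t ht].
  have -> : slope X i1 + slope Y i2 - slope X i1 = slope Y i2 by lia.
  have [->|/nX hx] := eqVneq (nform X (slope X i1) i1 j1) 0.
    by rewrite if_same !mul0r.
  have [->|/nY hy] := eqVneq (nform Y (slope Y i2) i2 j2) 0.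
    by rewrite if_same !mulr0.
  have -> : slope X i1 == slope X j1 by lia.
  by have -> : slope Y i2 == slope Y j2 by lia.
have [->|/nX hx] := eqVneq (nform X t i1 j1) 0; first by rewrite mul0r.
set k := _ - t.
have [->|/nY hy] := eqVneq (nform Y k i2 j2) 0; first by rewrite mulr0.
by rewrite /k in hy; move/eqP: ht; lia.
Qed.

(** Both compatibilities are checked on test vectors.  A morphism multiplies
    the eigenvalues of the test vectors by powers of [q], which does not change
    the weight ([wt_rel_shift]).  For a tensor product, [D (x) 1] evaluated on
    test vectors [U (x) U'] and [V (x) V'] has the factor [U' V'], which vanishes
    unless [U'] and [V'] have the same slope and eigenvalue; these then drop out
    of the difference of the slopes and of the ratio of the eigenvalues. *)
Lemma st_wt_part d c (D : fiber_endo q K) : Ell q c -> st a D ->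
  st_wt a d c (fun n X => wt_part X d c (D n X)).
Proof.
move=> hc /stP [[hmor htens hunit] hpure]; split; last by move=> n X; apply: wt_part_gwt.
apply/stP; split; last by move=> n X /hpure ->; rewrite wt_part0.
split; last by move=> Z /hunit ->; rewrite wt_part0.
- move=> n p X Y F hF.
  have [I [g [P [P1 lP rP _]]]] := graded_partition Y.
  have [J [h [Q [Q1 lQ rQ _]]]] := graded_partition X.
  have hD := hmor _ _ _ _ _ hF.
  have [s [G [hom Gslope Glead]]] := omega_decomp q0 a hF.
  apply: (sandwich_eq P1 Q1) => i j.
  transitivity ((wt_rel d c (g i) (h j))%:R *: (P i *m (D p Y *m omega a X Y F) *m Q j)).
    rewrite hom !mulmx_sumr !mulmx_suml scaler_sumr; apply: eq_bigr => k _.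
    rewrite -!scalemxAr -!scalemxAl [RHS]scalerA mulrC -scalerA; congr (_ *: _).
    have rG : right_geig Y ((h j).1, q ^ k * (h j).2) (G k *m Q j).
      have [hs [N hN]] := rQ j; split.
        move=> i' j' nz; apply/eqP; apply: contraNT nz => hne.
        rewrite mxE big1 // => l _; have [->|/Gslope e] := eqVneq (G k i' l) 0.
          by rewrite mul0r.
        have [->|/hs e'] := eqVneq (Q j l j') 0; first by rewrite mulr0.
        by rewrite /= e e' eqxx in hne.
      exists N; rewrite /= mulmxA (@twisted_pow _ _ _ (leadmx X)); last first.
        by rewrite Glead.
      by rewrite -scalemxAl -mulmxA hN mulmx0 scaler0.
    have := wt_partE d c (D p Y) (lP i) rG.
    rewrite !mulmxA => ->; congr (_%:R *: _).
    by case: (g i) (h j) => m x [m' y] /=; rewrite wt_rel_shift.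
  rewrite hD hom !mulmx_suml !mulmx_sumr !mulmx_suml scaler_sumr; apply: eq_bigr => k _.
  rewrite -!scalemxAl -!scalemxAr -!scalemxAl [LHS]scalerA mulrC -scalerA; congr (_ *: _).
  have lG : left_geig X ((g i).1, q ^ (- k) * (g i).2) (P i *m G k).
    have [hs [N hN]] := lP i; split.
      move=> i' j' nz; apply/eqP; apply: contraNT nz => hne.
      rewrite mxE big1 // => l _; have [->|/Gslope e] := eqVneq (G k l j') 0.
        by rewrite mulr0.
      have [->|/hs e'] := eqVneq (P i i' l) 0; first by rewrite mul0r.
      by rewrite /= -e e' eqxx in hne.
    have qk : q ^ k != 0 by rewrite expfz_neq0.
    exists N; rewrite /= -mulmxA.
    have := @twisted_pow _ _ _ (leadmx X) (leadmx Y) (G k) (q ^ k) (q ^ (- k) * (g i).2) N.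
    rewrite -Glead => /(_ erefl); rewrite mulrA -expfzDr // subrr expr0z mul1r => e.
    apply/eqP; rewrite -(inj_eq (scalerI (expf_neq0 N qk))) scaler0 scalemxAr -e.
    by rewrite mulmxA hN mul0mx.
  have := wt_partE d c (D n X) lG (rQ j).
  rewrite !mulmxA => ->; congr (_%:R *: _).
  case: (g i) (h j) => m x [m' y] /=.
  rewrite -(@wt_rel_shift _ _ _ _ _ y k hc) /wt_rel /=; congr (_ && `[< c _ >]).
  by rewrite -invr_expz invfM mulrA [_ * x]mulrC.
move=> m n X Y Z hZ; rewrite (htens _ _ _ _ _ hZ).
have [I [g [P [P1 lP rP _]]]] := graded_partition X.
have [J [h [Q [Q1 lQ rQ _]]]] := graded_partition Y.
pose PQ (ij : I * J) := tensmx (P ij.1) (Q ij.2).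
have PQ1 : \sum_ij PQ ij = 1%:M.
  rewrite -(pair_bigA _ (fun i j => tensmx (P i) (Q j))) /= -tensmx11 -P1 -Q1.
  apply/matrixP => i j; rewrite summxE !mxE !summxE mulr_suml.
  by apply: eq_bigr => k _; rewrite summxE mulr_sumr; apply: eq_bigr => l _; rewrite !mxE.
have hL := leadmx_tens hZ; have [_ hs _ _] := hZ.
have lPQ ij : left_geig Z ((g ij.1).1 + (h ij.2).1, (g ij.1).2 * (h ij.2).2) (PQ ij).
  have [s1 [N h1]] := lP ij.1; have [s2 [N' h2]] := lQ ij.2; split.
    move=> i' j'; rewrite mxE hs /= => nz.
    rewrite (s1 (mxtens_unindex i').1) ?(s2 (mxtens_unindex i').2) //.
      by apply: contraNneq nz => ->; rewrite mulr0.
    by apply: contraNneq nz => ->; rewrite mul0r.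
  by exists (N + N')%N; rewrite /= hL; apply: tens_left_geig h1 h2.
have rPQ ij : right_geig Z ((g ij.1).1 + (h ij.2).1, (g ij.1).2 * (h ij.2).2) (PQ ij).
  have [s1 [N h1]] := rP ij.1; have [s2 [N' h2]] := rQ ij.2; split.
    move=> i' j'; rewrite mxE hs /= => nz.
    rewrite (s1 _ (mxtens_unindex j').1) ?(s2 _ (mxtens_unindex j').2) //.
      by apply: contraNneq nz => ->; rewrite mulr0.
    by apply: contraNneq nz => ->; rewrite mul0r.
  by exists (N + N')%N; rewrite /= hL; apply: tens_right_geig h1 h2.
apply: (sandwich_eq PQ1 PQ1) => ij kl.
rewrite (wt_partE _ _ _ (lPQ ij) (rPQ kl)) /PQ !mulmxDr !mulmxDl !tensmx_mul !mulmx1.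
rewrite (wt_partE _ _ _ (lP _) (rP _)) (wt_partE _ _ _ (lQ _) (rQ _)).
have tZl (x : K) m1 n1 m2 n2 (A : 'M[K]_(m1, n1)) (B : 'M[K]_(m2, n2)) :
    tensmx (x *: A) B = x *: tensmx A B.
  by apply/matrixP => i' j'; rewrite !mxE mulrA.
have tZr (x : K) m1 n1 m2 n2 (A : 'M[K]_(m1, n1)) (B : 'M[K]_(m2, n2)) :
    tensmx A (x *: B) = x *: tensmx A B.
  by apply/matrixP => i' j'; rewrite !mxE mulrCA.
rewrite scalerDr tZl tZr; congr (_ + _).
  have [->|nz] := eqVneq (Q ij.2 *m Q kl.2) 0; first by rewrite tensmx0 !scaler0.
  have [e|ne] := eqVneq (h ij.2) (h kl.2); last first.
    by rewrite (left_right_orth (lQ _) (rQ _) ne) eqxx in nz.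
  have y0 : (h kl.2).2 != 0.
    by rewrite -e; apply: (left_geig_neq0 (lQ _)); apply: contraNneq nz => ->; rewrite mul0mx.
  rewrite /wt_rel /= e; congr ((_ && `[< c _ >])%:R *: _); first by congr (_ == _); lia.
  by rewrite -mulf_div divff // mulr1.
have [->|nz] := eqVneq (P ij.1 *m P kl.1) 0; first by rewrite tens0mx !scaler0.
have [e|ne] := eqVneq (g ij.1) (g kl.1); last first.
  by rewrite (left_right_orth (lP _) (rP _) ne) eqxx in nz.
have y0 : (g kl.1).2 != 0.
  by rewrite -e; apply: (left_geig_neq0 (lP _)); apply: contraNneq nz => ->; rewrite mul0mx.
rewrite /wt_rel /= e; congr ((_ && `[< c _ >])%:R *: _); first by congr (_ == _); lia.
by rewrite -mulf_div divff // mul1r.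
Qed.

End StWeight.

(** * Finitely many weights on each object *)

Section WeightDecomposition.
Variables (K : numClosedFieldType) (q a : K).
Hypothesis q0 : q != 0.

Lemma qspiral_self c : qspiral q c c.
Proof. by exists 0; rewrite expr0z mulr1. Qed.

Lemma qspiral_eq c x : qspiral q c x -> qspiral q c = qspiral q x.
Proof.
case=> k ->; apply/seteqP; split=> y [l ->].
  exists (l - k); rewrite -mulrA -expfzDr //; congr (_ * q ^ _); lia.
by exists (k + l); rewrite -mulrA -expfzDr.
Qed.

(** Each nonzero [p i M p j] has exactly one weight.  Any longer list of
    distinct weights serves as well, so that several objects can share one list. *)
Lemma wt_decomp n (X : E1 q n) (M : 'M[K]_n) : slope_ge (slope X) 1 M ->
  exists W : seq (nat * set K),
    (forall w, w \in W -> (0 < w.1)%N /\ Ell q w.2) /\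
    forall W', uniq W' -> {subset W <= W'} ->
      (forall w, w \in W' -> Ell q w.2) ->
      M = \sum_(w <- W') wt_part X w.1 w.2 M.
Proof.
move=> hM; have [I [g [p [p1 lp rp _]]]] := graded_partition X.
pose wt (ij : I * I) := (`|(g ij.2).1 - (g ij.1).1|%N, qspiral q ((g ij.1).2 / (g ij.2).2)).
pose nz (ij : I * I) := p ij.1 *m M *m p ij.2 != 0.
have hslope ij : nz ij -> 1 <= (g ij.2).1 - (g ij.1).1.
  rewrite /nz => h; rewrite leNgt; apply: contra h => hlt; apply/eqP/matrixP => i j.
  rewrite mxE [RHS]mxE big1 // => k _; rewrite mxE mulr_suml big1 // => l _.
  have [->|/(proj1 (lp ij.1)) s1] := eqVneq (p ij.1 i l) 0; first by rewrite !mul0r.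
  have [->|/hM s2] := eqVneq (M l k) 0; first by rewrite mulr0 mul0r.
  have [->|/(proj1 (rp ij.2)) s3] := eqVneq (p ij.2 k j) 0; first by rewrite mulr0.
  by rewrite -s1 -s3 in hlt; lia.
exists [seq wt ij | ij <- enum nz]; split.
  move=> w /mapP[ij]; rewrite mem_enum => hij ->; split=> /=.
    by have := hslope _ hij; lia.
  exists ((g ij.1).2 / (g ij.2).2) => //; apply: mulf_neq0.
    by apply: (left_geig_neq0 (lp _)); apply: contraNneq hij => ->; rewrite !mul0mx.
  rewrite invr_eq0; apply: (left_geig_neq0 (lp _)).
  by apply: contraNneq hij => ->; rewrite mulmx0.
move=> W' uW' sub ell.
rewrite {1}(sandwich M p1 p1).
have -> : \sum_(w <- W') wt_part X w.1 w.2 M =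
   \sum_(w <- W') \sum_i \sum_j (wt_rel w.1 w.2 (g i) (g j))%:R *: (p i *m M *m p j).
  apply: eq_bigr => w _.
  exact: (wt_part_unique (@wt_partP _ _ _ X w.1 w.2 M) (@wt_part_explicit _ _ _ _ _ _ M _ _ _ p1 lp rp)).
rewrite [RHS]exchange_big /=; apply: eq_bigr => i _.
rewrite [RHS]exchange_big /=; apply: eq_bigr => j _.
have [->|hij] := eqVneq (p i *m M *m p j) 0; first by rewrite big1 // => w _; rewrite scaler0.
have hw : wt (i, j) \in W'.
  by apply: sub; apply/mapP; exists (i, j) => //; rewrite mem_enum.
rewrite (bigD1_seq _ hw) //= big_seq_cond big1 ?addr0 => [|w /andP[ww' nw]].
  suff -> : wt_rel (wt (i, j)).1 (wt (i, j)).2 (g i) (g j) by rewrite scale1r.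
  rewrite /wt_rel; apply/andP; split; last by apply/asboolP; exact: qspiral_self.
  by have := hslope (i, j) hij; rewrite /=; lia.
case E : (wt_rel _ _ _ _); last by rewrite scale0r.
case/andP: E => /eqP e1 /asboolP e2; case/eqP: nw.
have [c0 _ ec] := ell _ ww'; rewrite [w]surjective_pairing /wt /=; congr (_, _).
  by rewrite e1.
by rewrite ec; apply: qspiral_eq; rewrite -ec.
Qed.

End WeightDecomposition.

(** * The unipotent Jordan factor and its logarithm *)

Section Jordan.
Variable K : numClosedFieldType.

(** On the eigenvectors of the semisimple factor [S], the matrix [L - x] acts
    as [x (U - 1)], hence nilpotently: they are generalized eigenvectors of
    [L]. *)
Lemma jordan_rows n (L S U : 'M[K]_n) x r (u : 'M[K]_(r, n)) N :
  L = S *m U -> S *m U = U *m S -> u *m S = x *: u ->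
  u *m (L - x%:M) ^+ N = x ^+ N *: (u *m (U - 1%:M) ^+ N).
Proof.
move=> LSU SU; elim: N u => [|N IH] u hu; first by rewrite !expr0 scale1r.
have h1 : u *m (L - x%:M) = x *: (u *m (U - 1%:M)).
  by rewrite LSU !mulmxBr mulmxA hu -scalemxAl mul_mx_scalar scalerBr mulmx1.
rewrite !exprS -!mulmxE !mulmxA h1 -scalemxAl IH ?scalerA //.
by rewrite mulmxBr mulmxBl -mulmxA -SU mulmxA hu mulmx1 hu -scalemxAl scalerBr.
Qed.

Lemma jordan_cols n (L S U : 'M[K]_n) x r (u : 'M[K]_(n, r)) N :
  L = S *m U -> S *m U = U *m S -> S *m u = x *: u ->
  (L - x%:M) ^+ N *m u = x ^+ N *: ((U - 1%:M) ^+ N *m u).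
Proof.
move=> LSU SU; elim: N u => [|N IH] u hu; first by rewrite !expr0 scale1r.
have h1 : (L - x%:M) *m u = x *: ((U - 1%:M) *m u).
  by rewrite LSU SU !mulmxBl mul1mx -mulmxA hu -scalemxAr mul_scalar_mx scalerBr.
rewrite !exprSr -!mulmxE -!mulmxA h1 -scalemxAr IH ?scalerA 1?mulrC //.
by rewrite mulmxBl mul1mx mulmxBr mulmxA SU -mulmxA hu -scalemxAr scalerBr.
Qed.

(** In a basis of eigenvectors of [S] on both sides, [B] has no entry between
    different eigenvalues, because these vectors are generalized eigenvectors of
    [L] and [B] commutes with [L].  So [B] commutes with [S], and with the
    quotient [U] of [L] by [S]. *)
Lemma jordan_uP n (L : 'M[K]_n) : L \in unitmx ->
  unipotent (jordan_u L) /\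
  forall B, L *m B = B *m L -> jordan_u L *m B = B *m jordan_u L.
Proof.
move=> uL; rewrite /jordan_u.
(* The default value 1 is unipotent and commutes with everything. *)
case: xgetP => [U _|_]; last first.
  split; last by move=> B _; rewrite mul1mx mulmx1.
  by rewrite /unipotent subrr; case: n {L uL} => [|n]; [apply/matrixP; case | rewrite expr0n].
case=> uU [S [[P uP dS] LSU SU]]; split=> // B hB.
have uS : S \in unitmx by move: uL; rewrite LSU unitmx_mul => /andP[].
have [d SE] := similar_diagLR uP dS; rewrite conjVmx // in SE.
have PS : P *m S = diag_mx d *m P by rewrite SE !mulmxA mulmxV // mul1mx.
have SP : S *m invmx P = invmx P *m diag_mx d by rewrite SE mulmxK.
have SB : S *m B = B *m S.
  have e : diag_mx d *m (P *m B *m invmx P) = P *m B *m invmx P *m diag_mx d.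
    apply/matrixP => i j; rewrite mul_diag_mx mul_mx_diag !mxE.
    have [->|dij] := eqVneq (d 0 i) (d 0 j); first by rewrite mulrC.
    suff : row i P *m B *m col j (invmx P) = 0.
      move/matrixP/(_ 0 0); rewrite -row_mul !mxE => h.
      have -> : \sum_k (P *m B) i k * invmx P k j = 0.
        by rewrite -[RHS]h; apply: eq_bigr => k _; rewrite !mxE.
      by rewrite mulr0 mul0r.
    apply: (@generalized_eigen_orth _ _ _ _ L (d 0 i) (d 0 j) n n) => //.
      have hr : row i P *m S = d 0 i *: row i P.
        by rewrite -row_mul PS mul_diag_mx; apply/rowP => k; rewrite !mxE.
      have cB : GRing.comm B ((L - (d 0 i)%:M) ^+ n).
        apply/commrX/commrB; first by apply/esym; exact: hB.
        exact: comm_mx_scalar.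
      rewrite -mulmxA; have -> : B *m (L - (d 0 i)%:M) ^+ n = (L - (d 0 i)%:M) ^+ n *m B.
        exact: cB.
      by rewrite mulmxA (jordan_rows _ LSU SU hr) uU mulmx0 scaler0 mul0mx.
    have hc : S *m col j (invmx P) = d 0 j *: col j (invmx P).
      apply/matrixP => k l; have := congr1 (fun M : 'M[K]_n => M k j) SP.
      rewrite mul_mx_diag !mxE mulrC => <-; apply: eq_bigr => m _.
      by rewrite !mxE.
    by rewrite (jordan_cols _ LSU SU hc) uU mul0mx scaler0.
  have := congr1 (fun M => invmx P *m M *m P) e.
  by rewrite !mulmxA mulmxKV // mulVmx // mul1mx SE !mulmxA.
have : S *m (U *m B) = S *m (B *m U).
  by rewrite mulmxA -LSU hB LSU !mulmxA SB.
by move/(congr1 (mulmx (invmx S))); rewrite !mulKmx.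
Qed.

Lemma logmx_nilpotent n (U : 'M[K]_n) : unipotent U -> logmx U ^+ n = 0.
Proof.
move=> uU; pose V := \sum_(1 <= k < n.+1) ((-1) ^+ k.+1 / k%:R : K) *: (U - 1%:M) ^+ k.-1.
have -> : logmx U = (U - 1%:M) * V.
  rewrite /logmx mulr_sumr; apply: eq_big_nat => k /andP[k0 _].
  by rewrite -mulmxE -scalemxAr mulmxE -exprS prednK.
rewrite exprMn_comm ?uU ?mul0r //.
apply: commr_sum => k _; rewrite /GRing.comm -!mulmxE -scalemxAl -scalemxAr !mulmxE.
by rewrite -exprS -exprSr.
Qed.

Lemma logmx_comm n (U B : 'M[K]_n) : U *m B = B *m U -> logmx U *m B = B *m logmx U.
Proof.
move=> h; apply/esym/commr_sum => k _.
rewrite /GRing.comm -!mulmxE -scalemxAl -scalemxAr !mulmxE; congr (_ *: _).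
apply/commrX/commrB; [exact/esym | exact: commr1].
Qed.

Variable q : K.

Lemma nu_nilpotent n (X : E1 q n) : nu q n X ^+ n = 0.
Proof. by apply: logmx_nilpotent; case: (jordan_uP (leadmx_unit X)). Qed.

Lemma nu_block n (X : E1 q n) i j : nu q n X i j != 0 -> slope X i = slope X j.
Proof.
move: i j; apply/slope_blockP => P; apply/esym/logmx_comm.
have [_ h] := jordan_uP (leadmx_unit X); apply: h; apply/esym.
by apply: (proj2 (slope_blockP (slope X) _)) => i j; apply: lead_block.
Qed.

End Jordan.

(** * Products in a nilpotent algebra of matrices *)

Section Words.
Variables (K : fieldType) (n : nat).

(** [words T k] spans the products of [k.+1] elements of [T]; it is the depth
    in which the error of the approximation is measured. *)
Inductive words (T : 'M[K]_n -> Prop) : nat -> 'M[K]_n -> Prop :=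
| words_gen x : T x -> words T 0 x
| words_mul k x y : T x -> words T k y -> words T k.+1 (x *m y)
| words_zero k : words T k 0
| words_add k x y : words T k x -> words T k y -> words T k (x + y)
| words_scale k t x : words T k x -> words T k (t *: x).

Lemma words_mulr (T : 'M[K]_n -> Prop) k x y :
  words T k x -> T y -> words T k.+1 (x *m y).
Proof.
move=> + Ty; elim=> {k x} [x Tx|k x z Tx _ IH|k|k x z _ IHx _ IHz|k t x _ IH].
- exact: words_mul Tx (words_gen Ty).
- by rewrite -mulmxA; apply: words_mul.
- by rewrite mul0mx; apply: words_zero.
- by rewrite mulmxDl; apply: words_add.
- by rewrite -scalemxAl; apply: words_scale.
Qed.

Lemma words_opp (T : 'M[K]_n -> Prop) k x : words T k x -> words T k (- x).
Proof. by move=> h; rewrite -scaleN1r; apply: words_scale. Qed.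

Lemma words_bracket (T : 'M[K]_n -> Prop) k x y :
  T x -> words T k y -> words T k.+1 (x *m y - y *m x).
Proof.
move=> Tx wy; apply: words_add; first exact: words_mul.
by apply/words_opp/words_mulr.
Qed.

Variables (mu : 'I_n -> int) (v : 'M[K]_n).

(** The shape of the elements of [st_tilde], with [v] the value of [nu]. *)
Definition strict_modulo (M : 'M[K]_n) : Prop := exists t, slope_ge mu 1 (M - t *: v).

Hypothesis v_ge0 : slope_ge mu 0 v.
Hypothesis v_nil : v ^+ n = 0.

Lemma strict_modulo_ge0 x : strict_modulo x -> slope_ge mu 0 x.
Proof.
case=> t h; rewrite -[x](subrK (t *: v)); apply: slope_geD; last exact: slope_geZ.
exact: slope_geW h.
Qed.

(** Multiplying an element of depth [s] in the slope filtration [n] times by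
    factors [t v + u], with [u] strictly triangular, gives a multiple of [v^n],
    which is zero, up to terms of depth [s + 1]. *)
Lemma words_slope_ge s k M :
  (s * n <= k)%N -> words strict_modulo k M -> slope_ge mu s%:Z M.
Proof.
elim: s k M => [|s IHs] k M hk w.
  elim: w => {k M hk} [x /strict_modulo_ge0 //|k x y /strict_modulo_ge0 hx _ hy|k
                      |k x y _ hx _ hy|k t x _ hx].
  - by rewrite -[0%:Z]addr0; apply: slope_geM.
  - exact: slope_ge0_zero.
  - exact: slope_geD.
  - exact: slope_geZ.
(* [j] counts the factors already split off on the left. *)
suff h j : (s * n + j <= k)%N -> exists2 M', slope_ge mu s%:Z M' &
    slope_ge mu s.+1%:Z (M - v ^+ j *m M').
  have [|M' _] := h n; first by rewrite addnC -mulSn.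
  by rewrite v_nil mul0mx subr0.
have base m (x : 'M[K]_n) : (s * n + 0 <= m)%N -> words strict_modulo m x ->
    exists2 M', slope_ge mu s%:Z M' & slope_ge mu s.+1%:Z (x - v ^+ 0 *m M').
  rewrite addn0 => hm wx; exists x; first exact: IHs wx.
  by rewrite expr0 mul1mx subrr; exact: slope_ge0_zero.
elim: w j => {hk} [x Tx|m x y Tx wy IH|m|m x y _ IHx _ IHy|m t x _ IH] j hj.
- case: j hj => [|j]; last by rewrite addnS.
  by move=> hm; apply: base hm _; apply: words_gen.
- case: j hj => [hm|j hj]; first by apply: base hm _; apply: words_mul.
  have [M' h1 h2] := IH j ltac:(lia).
  have [t ht] := Tx; exists (t *: M'); first exact: slope_geZ.
  have -> : x *m y - v ^+ j.+1 *m (t *: M') =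
      x *m (y - v ^+ j *m M') + (x - t *: v) *m (v ^+ j *m M').
    rewrite mulmxBr mulmxBl -scalemxAr -scalemxAl exprS -mulmxE !mulmxA.
    by rewrite addrA subrK.
  apply: slope_geD.
    by rewrite -[s.+1%:Z]add0r; apply: slope_geM h2; apply: strict_modulo_ge0.
  have -> : s.+1%:Z = 1 + (0 *+ j + s%:Z) :> int by rewrite mul0rn; lia.
  by apply: slope_geM => //; apply: slope_geM => //; apply: slope_geX.
- exists 0; first exact: slope_ge0_zero.
  by rewrite mulmx0 subr0; exact: slope_ge0_zero.
- have [M1 h1 h1'] := IHx j hj; have [M2 h2 h2'] := IHy j hj.
  exists (M1 + M2); first exact: slope_geD.
  by rewrite mulmxDr opprD addrACA; apply: slope_geD.
- have [M1 h1 h1'] := IH j hj; exists (t *: M1); first exact: slope_geZ.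
  by rewrite -scalemxAr -scalerBr; apply: slope_geZ.
Qed.

Lemma words_large k M :
  ((slope_range mu + slope_range mu).+1 * n <= k)%N -> words strict_modulo k M -> M = 0.
Proof.
move=> hk w; apply: (@slope_ge_large _ _ mu _ _ _ (words_slope_ge hk w)).
by rewrite ltz_nat.
Qed.

End Words.

(** * Generation modulo the derived ideal *)

Section Generation.
Variables (K : numClosedFieldType) (q a : K).
Hypothesis q0 : q != 0.
Local Notation fam := (fiber_endo q K).
Local Notation T X := (strict_modulo (slope X) (nu q _ X)).

Lemma fiber_endo_ext (D E : fam) : (forall m (Y : E1 q m), D m Y = E m Y) -> D = E.
Proof.
move=> h; apply: functional_extensionality_dep => m.
by apply: functional_extensionality_dep => Y.
Qed.

Lemma st_zero : st a (@fzero K q).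
Proof.
apply/stP; split=> //; split=> *; rewrite /fzero ?mul0mx ?mulmx0 //.
by rewrite tens0mx tensmx0 addr0.
Qed.

Lemma nu_st_tilde : st_tilde q a (nu q).
Proof.
exists 1, (@fzero K q); split; first exact: st_zero.
by apply: fiber_endo_ext => n X; rewrite /fadd /fscale /fzero scale1r addr0.
Qed.

Lemma st_st_tilde D : st a D -> st_tilde q a D.
Proof.
exists 0, D; split=> //.
by apply: fiber_endo_ext => n X; rewrite /fadd /fscale scale0r add0r.
Qed.

Lemma st_tilde_strict_modulo D n (X : E1 q n) : st_tilde q a D -> T X (D n X).
Proof.
case=> t [E [hE ->]]; exists t; rewrite /fadd /fscale addrC addKr.
exact: (st_slope_ge1 hE).
Qed.

Lemma fsum_lie_span (S : set fam) r (E : 'I_r -> fam) :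
  (forall k, lie_span S (E k)) -> lie_span S (fsum E).
Proof.
elim: r E => [|r IH] E hE.
  have -> : fsum E = @fzero K q; last exact: lie_span_zero.
  by apply: fiber_endo_ext => n X; rewrite /fsum big_ord0.
have -> : fsum E = fadd (E ord0) (fsum (fun k => E (lift ord0 k))).
  by apply: fiber_endo_ext => n X; rewrite /fsum /fadd big_ord_recl.
by apply: lie_span_add => //; apply: IH.
Qed.

Variable S : set fam.
Hypothesis S_st : S `<=` st_tilde q a.
Hypothesis S_nu : S (nu q).
Hypothesis S_gen : forall d c D, (0 < d)%N -> Ell q c -> st_wt a d c D ->
  exists2 E, lie_span S E & derived (st_tilde q a) (fadd D (fscale (-1) E)).

(** The bracket of [t v + u] and [t' v + u'] is strictly triangular, as the
    multiples of [v] commute. *)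
Lemma lie_span_strict_modulo E n (X : E1 q n) : lie_span S E -> T X (E n X).
Proof.
elim=> {E} [D /S_st|||x D _ [t h]|D E _ [t h] _ [u h']].
- exact: st_tilde_strict_modulo.
- exists 0; rewrite scale0r subr0; exact: slope_ge0_zero.
- move=> D E _ [t h] _ [u h']; exists (t + u); rewrite /fadd scalerDl opprD addrACA.
  exact: slope_geD.
- exists (x * t); rewrite /fscale -scalerA -scalerBr; exact: slope_geZ.
exists 0; rewrite scale0r subr0 /bracket.
have hv : slope_ge (slope X) 0 (nu q n X).
  by apply: slope_block_ge0 => i j; apply: nu_block.
set x := D n X in h *; set y := E n X in h' *; set v := nu q n X in h h' hv *.
have -> : x *m y - y *m x = ((x - t *: v) *m y - y *m (x - t *: v)) +
    ((t *: v) *m (y - u *: v) - (y - u *: v) *m (t *: v)).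
  have cv : (t *: v) *m (u *: v) = (u *: v) *m (t *: v).
    by rewrite -!scalemxAl -!scalemxAr !scalerA mulrC.
  rewrite !mulmxBl !mulmxBr cv.
  move: (x *m y) (y *m x) (_ *m y) (y *m (_ *: _)) (_ *m _) => A B C E' G.
  by apply/matrixP => i j; rewrite !mxE; ring.
have hy : slope_ge (slope X) 0 y by apply: (strict_modulo_ge0 hv); exists u.
have hy' : slope_ge (slope X) 0 (t *: v) by exact: slope_geZ.
have geM01 := @slope_geM K n (slope X) 0 1.
have geM10 := @slope_geM K n (slope X) 1 0.
rewrite add0r addr0 in geM01 geM10.
by apply: slope_geD; apply: slope_geD; try apply: slope_geN;
  first [exact: geM01 | exact: geM10].
Qed.

Section Family.
Variables (r : nat) (n : 'I_r -> nat) (X : forall i, E1 q (n i)).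

(** [D] agrees on the objects [X i] with an element of the Lie algebra spanned
    by [S], up to products of [k.+1] factors. *)
Definition generated_upto (k : nat) (D : fam) : Prop :=
  exists2 E, lie_span S E & forall i, words (T (X i)) k (D _ (X i) - E _ (X i)).

Lemma generated_upto_fsum k s (D : 'I_s -> fam) :
  (forall t, generated_upto k (D t)) -> generated_upto k (fsum D).
Proof.
move=> /fin_all_exists2 [E hE hw]; exists (fsum E); first exact: fsum_lie_span.
move=> i; rewrite /fsum -sumrB; elim/big_ind: _ => [|x y|t _]; last exact: hw.
  exact: words_zero.
exact: words_add.
Qed.

Lemma generated_upto_ext k (D D' : fam) :
  (forall i, D _ (X i) = D' _ (X i)) -> generated_upto k D -> generated_upto k D'.
Proof. by move=> h [E hE hw]; exists E => // i; rewrite -h. Qed.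

Lemma generated_upto_add k (D D' : fam) : generated_upto k D -> generated_upto k D' -> generated_upto k (fadd D D').
Proof.
case=> [E hE hw] [E' hE' hw']; exists (fadd E E'); first exact: lie_span_add.
by move=> i; rewrite /fadd opprD addrACA; apply: words_add.
Qed.

Lemma generated_upto_span k E : lie_span S E -> generated_upto k E.
Proof. by exists E => // i; rewrite subrr; apply: words_zero. Qed.

(** With the approximations [b] of [x] and [c] of [y], the difference of
    [[x, y]] and [[b, c]] is [[x, y - c] - [c, x - b]], in which both errors have
    gained a factor. *)
Lemma generated_upto_bracket k x y : st_tilde q a x -> st_tilde q a y ->
  generated_upto k x -> generated_upto k y -> generated_upto k.+1 (bracket x y).
Proof.
move=> hx hy [b hb wb] [c hc wc]; exists (bracket b c); first exact: lie_span_bracket.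
move=> i; rewrite /bracket.
have Tx := st_tilde_strict_modulo (X i) hx; have Tc := lie_span_strict_modulo (X i) hc.
move: (wb i) (wc i) Tx Tc.
set x' := x _ _; set y' := y _ _; set b' := b _ _; set c' := c _ _ => w w' Tx Tc.
have -> : x' *m y' - y' *m x' - (b' *m c' - c' *m b') =
   (x' *m (y' - c') - (y' - c') *m x') - (c' *m (x' - b') - (x' - b') *m c').
  rewrite !mulmxBl !mulmxBr.
  move: (x' *m y') (y' *m x') (b' *m c') (c' *m b') (x' *m c') (c' *m x').
  by move=> A1 A2 A3 A4 A5 A6; apply/matrixP => i' j'; rewrite !mxE; ring.
apply: words_add; last apply: words_opp; exact: words_bracket.
Qed.

(** An element of [st] is on the given objects a sum of components of pure
    weight, and each of these is an element of the span plus brackets of elements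
    of [st_tilde], to which the induction hypothesis applies. *)
Lemma generated_upto_st_tilde k D : st_tilde q a D -> generated_upto k D.
Proof.
elim: k D => [|k IH] D.
  move=> hD; exists (@fzero K q); first exact: lie_span_zero.
  by move=> i; rewrite subr0; apply: words_gen; apply: st_tilde_strict_modulo.
case=> t [E [hE ->]]; apply: generated_upto_add.
  by apply/generated_upto_span/lie_span_scale/lie_span_gen.
have /fin_all_exists2 [W hW1 hW2] : forall i, exists2 W : seq (nat * set K),
    (forall w, w \in W -> (0 < w.1)%N /\ Ell q w.2) &
    forall W', uniq W' -> {subset W <= W'} ->
      (forall w, w \in W' -> Ell q w.2) ->
      E _ (X i) = \sum_(w <- W') wt_part (X i) w.1 w.2 (E _ (X i)).
  move=> i; have hs : slope_ge (slope (X i)) 1 (E _ (X i)) by apply: (st_slope_ge1 hE).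
  by have [W [h1 h2]] := wt_decomp q0 hs; exists W.
pose U := undup (flatten [seq W i | i <- enum 'I_r]).
have UP w : w \in U -> (0 < w.1)%N /\ Ell q w.2.
  by rewrite mem_undup => /flatten_mapP[i _]; apply: hW1.
pose Dw (s : 'I_(size U)) : fam :=
  fun m Y => wt_part Y (tnth (in_tuple U) s).1 (tnth (in_tuple U) s).2 (E m Y).
apply: (@generated_upto_ext _ (fsum Dw)).
  move=> i; rewrite [RHS](hW2 i U) ?undup_uniq //; last by move=> w /UP[].
    rewrite /fsum /Dw; rewrite [RHS]big_tnth; by [].
  move=> w wW; rewrite mem_undup; apply/flatten_mapP; exists i => //.
  by rewrite mem_enum.
apply: generated_upto_fsum => s.
set w := tnth (in_tuple U) s.
have [w1 w2] : (0 < w.1)%N /\ Ell q w.2 by apply: UP; exact: mem_tnth.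
have [F hF hder] := S_gen w1 w2 (st_wt_part q0 w.1 w2 hE).
have [G [m [x [y [hx hy GE]]]] hG] := hder r n X.
apply: (@generated_upto_ext _ (fadd F G)).
  move=> i; rewrite /fadd hG /fadd /fscale scaleN1r addrC subrK.
  by [].
apply: generated_upto_add; first exact: generated_upto_span.
rewrite GE; apply: generated_upto_fsum => t'.
by apply: generated_upto_bracket => //; apply: IH.
Qed.

Lemma generation_family D : st_tilde q a D ->
  exists2 E, lie_span S E & forall i, E _ (X i) = D _ (X i).
Proof.
pose k := (\sum_i (slope_range (slope (X i)) + slope_range (slope (X i))).+1 * n i)%N.
move=> /(generated_upto_st_tilde k) [E hE hw]; exists E => // i.
apply/esym/eqP; rewrite -subr_eq0; apply/eqP; apply: words_large (hw i).
- by apply: slope_block_ge0 => i' j'; apply: nu_block.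
- exact: nu_nilpotent.
- by rewrite /k (bigD1 i) //= leq_addr.
Qed.

End Family.

Lemma generation : topologically_generates S (st_tilde q a).
Proof. by split=> // D hD r n X; apply: generation_family. Qed.

End Generation.

Theorem proposition3p6 (R : realType) (q a : R[i]) (c0 : set R[i])
  (hq : 1 < `|q|) (ha : a != 0) (hc0 : Ell q c0)
  (Delta : set R[i] -> fiber_endo q R[i])
  (hDelta : forall alpha, Ell q alpha ->
     is_alien_derivation a c0 alpha (Delta alpha))
  (alpha : forall d : nat, set R[i] -> 'I_d -> set R[i])
  (Ddot : forall d : nat, set R[i] -> 'I_d -> fiber_endo q R[i])
  (hDdot : forall (d : nat) (c : set R[i]), (0 < d)%N -> Ell q c ->
     [/\ forall i : 'I_d, Ell q (alpha d c i) /\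
           (exists2 x, alpha d c i x & c (x ^+ d)),
         forall i : 'I_d,
           component_of a d c (Delta (alpha d c i)) (Ddot d c i) &
         basis_mod (st_wt a d c) (derived (st_tilde q a)) (Ddot d c)]) :
  topologically_generates
    ([set D : fiber_endo q R[i] | D = nu q \/
        exists (d : nat) (c : set R[i]) (i : 'I_d),
          [/\ (0 < d)%N, Ell q c & D = Ddot d c i]])
    (st_tilde q a).
Proof.
have q0 : q != 0 by apply: contraTneq hq => ->; rewrite normr0 ltr10.
apply: generation => //; last 2 first.
- by left.
- move=> d c D d0 hc hD; have [_ _ [_ _ hspan]] := hDdot d c d0 hc.
  have [x hx] := hspan D hD.
  exists (fsum (fun i => fscale (x i) (Ddot d c i))) => //.
  apply: fsum_lie_span => i; apply/lie_span_scale/lie_span_gen; right.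
  by exists d, c, i.
move=> D [->|[d [c [i [d0 hc ->]]]]]; first exact: nu_st_tilde.
by have [_ h _] := hDdot d c d0 hc; have [[hst _] _] := h i; apply: st_st_tilde.
Qed.
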